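(* Let $m,n,r,d$ be integers with $m,n\ge2$, $d\ge1$, $0<r<\min\{m,n\}$, and for $0\le a\le rd$ let $d_R=\lfloor a/r\rfloor$, $t_R=a\bmod r$, $\alpha=\lfloor a/(n-r)\rfloor$, $s=a\bmod(n-r)$, $\beta=\lfloor (rd-a)/(m-r)\rfloor$, $t=(rd-a)\bmod(m-r)$. All factors below are $L\in\mathbb{C}[\lambda]^{m\times r}$, $R\in\mathbb{C}[\lambda]^{r\times n}$. Define: $\mathcal{A}_a$: products $LR$ with $\deg(L_{*i})+\deg(R_{i*})=d$ for all $i$ and $\sum_i\deg(R_{i*})=a$; $\mathcal{B}_a$: products $LR$ with $\deg(R_{i*})=d_R+1$ ($i\le t_R$), $\deg(R_{i*})=d_R$ ($i>t_R$), $\deg(L_{*i})=d-\deg(R_{i*})$ (all $i$); $\mathcal{M}_a$: products $LR$ whose factors satisfy the conditions of $\mathcal{B}_a$ and the columns of $L$ and the rows of $R$ are minimal bases; $\mathcal{MH}_a$: products $LR$ whose factors satisfy the conditions of $\mathcal{M}_a$ and $\mathcal{N}_\ell(L)$ has minimal indices $\beta+1$ ($t$ times), $\beta$ ($m-r-t$ times), and $\mathcal{N}_r(R)$ has minimal indices $\alpha+1$ ($s$ times), $\alpha$ ($n-r-s$ times); $\mathcal{C}_a$: products $LR$ with $\deg(R_{i*})\le d_R+1$ and $\deg(L_{*i})\le d-d_R-1$ for $i\le t_R$, and $\deg(R_{i*})\le d_R$ and $\deg(L_{*i})\le d-d_R$ for $t_R<i\le r$. Let $\mathcal{O}_a$ be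 the set of all $P\in\mathbb{C}[\lambda]^{m\times n}_d$ of normal rank $r$ whose $r$ invariant polynomials are all equal to $1$, whose partial multiplicity sequence at $\infty$ (with respect to $d$) consists of zeros, whose left nullspace $\mathcal{N}_\ell(P)$ has minimal indices $\beta+1$ ($t$ times) and $\beta$ ($m-r-t$ times), and whose right nullspace $\mathcal{N}_r(P)$ has minimal indices $\alpha+1$ ($s$ times) and $\alpha$ ($n-r-s$ times). Then for every $a=0,1,\dots,rd$: (i) $\mathcal{O}_a\subseteq\mathcal{A}_a$; (ii) $\mathcal{MH}_a\subseteq\mathcal{O}_a$; (iii) $\overline{\mathcal{O}_a}=\overline{\mathcal{MH}_a}=\overline{\mathcal{M}_a}=\overline{\mathcal{B}_a}=\overline{\mathcal{C}_a}=\overline{\mathcal{A}_a}$.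
   Context: $\mathbb{C}[\lambda]^{m\times n}_d$: complex $m\times n$ polynomial matrices of degree at most $d$; degree of a polynomial vector/matrix is the maximum degree of its entries, $\deg0=-\infty$; $L_{*i}$ is the $i$th column and $R_{i*}$ the $i$th row. Normal rank is rank over $\mathbb{C}(\lambda)$. A minimal basis of a subspace of $\mathbb{C}(\lambda)^k$ is a basis of polynomial vectors with minimal sum of degrees; its degrees (the minimal indices) are independent of the choice. $\mathcal{N}_\ell(X)=\{y:yX=0\}$, $\mathcal{N}_r(X)=\{x:Xx=0\}$ over $\mathbb{C}(\lambda)$. Invariant polynomials are the nonzero diagonal entries of the Smith form. The partial multiplicity sequence of $P$ at $\alpha_0\in\mathbb{C}$ is the list of exponents $\sigma_j$ of $(\lambda-\alpha_0)$ in the invariant polynomials $e_1,\dots,e_r$; the partial multiplicity sequence at $\infty$ (with respect to $d$) is that of $\lambda^dP(1/\lambda)$ at $0$. Closures are taken in $\mathbb{C}[\lambda]^{m\times n}_d$ with the metric $\mathrm{dist}(P,Q)=(\sum_{i=0}^d\|P_i-Q_i\|_F^2)^{1/2}$, $P_i,Q_i$ the coefficients of $\lambda^i$. *)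

(* Defs.v *)
From mathcomp Require Import all_boot all_order all_algebra.
From mathcomp Require Import complex reals.
Set Implicit Arguments. Unset Strict Implicit. Unset Printing Implicit Defensive.
Import Order.TTheory GRing.Theory Num.Theory.
Local Open Scope ring_scope.

Section PolyMx.
Variable R : realType.
Local Notation C := R[i].
Local Notation PC := {poly C}.
Local Notation FC := {fraction {poly C}}.

Definition fracmx m n (A : 'M[PC]_(m, n)) : 'M[FC]_(m, n) :=
  map_mx (@tofrac _) A.

(* mxsize A = 1 + deg A, where deg A is the maximal degree of the entries,
   and mxsize A = 0 iff A = 0 (deg 0 = -oo).  Thus
     deg A = k   <->  mxsize A = k.+1
     deg A <= k  <->  mxsize A <= k.+1 . *)
Definition mxsize m n (A : 'M[PC]_(m, n)) : nat :=
  \max_(ij : 'I_m * 'I_n) size (A ij.1 ij.2).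

(* degree of the i-th row of a polynomial matrix (meaningful for nonzero rows) *)
Definition rowdeg p k (B : 'M[PC]_(p, k)) (i : 'I_p) : nat :=
  (mxsize (row i B)).-1.

Definition sumdeg p k (B : 'M[PC]_(p, k)) : nat := \sum_(i < p) rowdeg B i.

Definition poly_basis_of q p k (S : 'M[FC]_(q, k)) (B : 'M[PC]_(p, k)) : bool :=
  row_free (fracmx B) && (fracmx B == S)%MS.

Definition minimal_basis_of q p k (S : 'M[FC]_(q, k)) (B : 'M[PC]_(p, k)) : Prop :=
  poly_basis_of S B /\
  forall B' : 'M[PC]_(p, k), poly_basis_of S B' -> (sumdeg B <= sumdeg B')%N.

Definition is_minimal_basis p k (B : 'M[PC]_(p, k)) : Prop :=
  minimal_basis_of (fracmx B) B.

Definition minimal_indices q k (S : 'M[FC]_(q, k)) (s : seq nat) : Prop :=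
  exists p (B : 'M[PC]_(p, k)),
    minimal_basis_of S B /\ perm_eq [seq rowdeg B i | i <- enum 'I_p] s.

Definition lnull m n (A : 'M[PC]_(m, n)) : 'M[FC]_m := kermx (fracmx A).
Definition rnull m n (A : 'M[PC]_(m, n)) : 'M[FC]_n := kermx (fracmx A)^T.

Definition normal_rank m n (A : 'M[PC]_(m, n)) : nat := \rank (fracmx A).

Definition unimodular n (U : 'M[PC]_n) : bool := \det U \is a GRing.unit.

Definition diag_seq m n (e : seq PC) : 'M[PC]_(m, n) :=
  \matrix_(i < m, j < n) if (i == j :> nat) && (i < size e)%N then e`_i else 0.

Definition invariant_polys m n (A : 'M[PC]_(m, n)) (e : seq PC) : Prop :=
  [/\ (size e <= minn m n)%N,
      all (fun p : PC => p \is monic) e,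
      (forall i, (i.+1 < size e)%N -> e`_i %| e`_i.+1) &
      exists (U : 'M[PC]_m) (V : 'M[PC]_n),
        [/\ unimodular U, unimodular V & U *m A *m V = diag_seq m n e]].

Definition partial_mult_seq m n (A : 'M[PC]_(m, n)) (a0 : C) (s : seq nat) : Prop :=
  exists e, invariant_polys A e /\ s = [seq mup a0 p | p <- e].

(* lambda^d p(1/lambda) for deg p <= d *)
Definition revd (d : nat) (p : PC) : PC := \poly_(k < d.+1) p`_(d - k).

Definition partial_mult_seq_inf m n (d : nat) (A : 'M[PC]_(m, n)) (s : seq nat) : Prop :=
  partial_mult_seq (map_mx (revd d) A) 0 s.

Definition dist2 m n (d : nat) (P Q : 'M[PC]_(m, n)) : C :=
  \sum_(k < d.+1) \sum_(i < m) \sum_(j < n) `|(P i j)`_k - (Q i j)`_k| ^+ 2.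

Definition closure_d m n (d : nat) (S : 'M[PC]_(m, n) -> Prop) (P : 'M[PC]_(m, n)) : Prop :=
  (mxsize P <= d.+1)%N /\
  forall eps : C, 0 < eps ->
    exists Q, [/\ S Q, (mxsize Q <= d.+1)%N & dist2 d P Q < eps * eps].

Definition pset_eq T (S1 S2 : T -> Prop) : Prop := forall x, S1 x <-> S2 x.
Definition psubset T (S1 S2 : T -> Prop) : Prop := forall x, S1 x -> S2 x.

(* ---- the sets of the theorem; index i of the paper is i.+1 here ---- *)
Section Sets.
Variables (m n r d a : nat).

Definition dR := (a %/ r)%N.
Definition tR := (a %% r)%N.
Definition alpha := (a %/ (n - r))%N.
Definition s_ := (a %% (n - r))%N.
Definition beta := ((r * d - a) %/ (m - r))%N.
Definition t_ := ((r * d - a) %% (m - r))%N.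

Definition degRB (i : 'I_r) : nat := if (i < tR)%N then dR.+1 else dR.

Definition Aset (P : 'M[PC]_(m, n)) : Prop :=
  exists (L : 'M[PC]_(m, r)) (Rf : 'M[PC]_(r, n)), P = L *m Rf /\
    exists e : 'I_r -> nat,
      (forall i, [/\ (e i <= d)%N, mxsize (row i Rf) = (e i).+1
                   & mxsize (col i L) = (d - e i).+1]) /\
      (\sum_(i < r) e i)%N = a.

Definition condB (L : 'M[PC]_(m, r)) (Rf : 'M[PC]_(r, n)) : Prop :=
  forall i, mxsize (row i Rf) = (degRB i).+1 /\ mxsize (col i L) = (d - degRB i).+1.

Definition condM (L : 'M[PC]_(m, r)) (Rf : 'M[PC]_(r, n)) : Prop :=
  [/\ condB L Rf, is_minimal_basis L^T & is_minimal_basis Rf].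

Definition left_indices : seq nat := nseq t_ beta.+1 ++ nseq (m - r - t_) beta.
Definition right_indices : seq nat := nseq s_ alpha.+1 ++ nseq (n - r - s_) alpha.

Definition condMH (L : 'M[PC]_(m, r)) (Rf : 'M[PC]_(r, n)) : Prop :=
  [/\ condM L Rf, minimal_indices (lnull L) left_indices
    & minimal_indices (rnull Rf) right_indices].

Definition Bset (P : 'M[PC]_(m, n)) : Prop :=
  exists L Rf, P = L *m Rf /\ condB L Rf.
Definition Mset (P : 'M[PC]_(m, n)) : Prop :=
  exists L Rf, P = L *m Rf /\ condM L Rf.
Definition MHset (P : 'M[PC]_(m, n)) : Prop :=
  exists L Rf, P = L *m Rf /\ condMH L Rf.

Definition Cset (P : 'M[PC]_(m, n)) : Prop :=
  exists (L : 'M[PC]_(m, r)) (Rf : 'M[PC]_(r, n)), P = L *m Rf /\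
    forall i : 'I_r,
      if (i < tR)%N
      then (mxsize (row i Rf) <= dR.+2)%N /\ (mxsize (col i L) <= (d - dR - 1).+1)%N
      else (mxsize (row i Rf) <= dR.+1)%N /\ (mxsize (col i L) <= (d - dR).+1)%N.

Definition Oset (P : 'M[PC]_(m, n)) : Prop :=
  [/\ (mxsize P <= d.+1)%N /\ normal_rank P = r,
      invariant_polys P (nseq r 1),
      partial_mult_seq_inf d P (nseq r 0%N),
      minimal_indices (lnull P) left_indices
    & minimal_indices (rnull P) right_indices].

End Sets.
End PolyMx.

Arguments Aset R m n r d a P : clear implicits.
Arguments Bset R m n r d a P : clear implicits.
Arguments Cset R m n r d a P : clear implicits.
Arguments Mset R m n r d a P : clear implicits.
Arguments MHset R m n r d a P : clear implicits.
Arguments Oset R m n r d a P : clear implicits.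

(* Main.v *)
Require Import Defs.
From mathcomp Require Import all_boot all_order all_algebra all_fingroup.
From mathcomp Require Import complex reals boolp.
From mathcomp Require Import zify ring.

(** Every product in A_a is a product L R with row degrees of R at most e_i and column
    degrees of L at most d - e_i, for some e with sum a.  A rank-two update depending on
    a parameter eps moves one degree unit between two rows and converges to the given
    product, so e may be balanced: A_a lies in the closure of C_a.  Products in C_a are
    limits of products in MH_a: for balanced degrees, the map x |-> R x on vectors x of
    suitably bounded degrees is a square linear system, its nonsingularity is an open
    condition on R that holds at an explicit sparse R, and it forces R(x) to have full
    rank everywhere, the leading coefficient matrix of R to have full rank, and the right
    minimal indices to be balanced; the same holds for the transpose of L.  Finally O_a
    lies in A_a: a minimal basis R of the row space of P in O_a gives P = L R, the degree
    sums of dual minimal bases agree, and the predictable degree property then forces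
    deg L_{*i} + deg R_{i*} = d. *)

(** * Evaluation at points, degree bounds, and the predictable degree property *)

Section Pointwise.
Set Implicit Arguments. Unset Strict Implicit. Unset Printing Implicit Defensive.
Import Order.TTheory GRing.Theory Num.Theory.
Local Open Scope ring_scope.
Variable R : realType.
Local Notation C := R[i].
Local Notation PC := {poly C}.

(** A least degree sum is awkward to verify or to exploit, so minimality is traded for two rank
    conditions: full row rank at every point of C ([pw_free]) and a leading matrix [leadmx] of full
    row rank. [reduced_minimal] passes from them to minimality; [minimal_reduced] and
    [minimal_pw_free] pass back. One injectivity statement yields every generic property because the
    linear system is square: its kernel controls the nullspace, and its image gives right inverses
    of the matrix and of its leading matrix. Openness is made algebraic: from any matrix, the line
    in the direction of a nonsingular witness is singular for at most finitely many parameters,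
    found among the eigenvalues of a constant matrix, so arbitrarily small good parameters exist.
    Moving both factors along such lines makes the product a quadratic curve through the given one.
    In the inclusion of O_a in A_a the cofactor [L] is not known to be reduced; hence [dual_sum_le]
    is an inequality that asks for a full-rank leading matrix on one side only. *)

Definition ev (x : C) m n (A : 'M[PC]_(m, n)) : 'M[C]_(m, n) :=
  map_mx (horner_eval x) A.

Definition pw_free p k (B : 'M[PC]_(p, k)) := forall x : C, row_free (ev x B).

Definition rowbd p k (e : 'I_p -> nat) (B : 'M[PC]_(p, k)) :=
  forall i j, (size (B i j) <= (e i).+1)%N.

(** Coefficients are taken at the prescribed bounds [e i], not at the actual degrees: a row of
    smaller degree contributes a zero row, so full rank forces the bounds to be attained
    ([rowdeg_reduced]). *)
Definition leadmx p k (e : 'I_p -> nat) (B : 'M[PC]_(p, k)) : 'M[C]_(p, k) :=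
  \matrix_(i, j) (B i j)`_(e i).

Lemma mxsizeP m n (A : 'M[PC]_(m, n)) k :
  reflect (forall i j, (size (A i j) <= k)%N) (mxsize A <= k)%N.
Proof.
apply: (iffP idP) => [/bigmax_leqP h i j | h]; first exact: (h (i, j)).
by apply/bigmax_leqP => -[i j] _; apply: h.
Qed.

Lemma mxsize_rowP m n (A : 'M[PC]_(m, n)) i k :
  reflect (forall j, (size (A i j) <= k)%N) (mxsize (row i A) <= k)%N.
Proof.
apply: (iffP (mxsizeP _ _)) => [h j | h u j]; last by rewrite mxE.
by have := h 0 j; rewrite mxE.
Qed.

Lemma mxsize_tr m n (A : 'M[PC]_(m, n)) : mxsize A^T = mxsize A.
Proof.
have le p q (B : 'M[PC]_(p, q)) : (mxsize B^T <= mxsize B)%N.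
  by apply/mxsizeP => i j; rewrite mxE; move: j i; apply/mxsizeP.
by apply/eqP; rewrite eqn_leq; apply/andP; split; [|rewrite -{1}[A]trmxK]; apply: le.
Qed.

Lemma rowbd_rowdeg p k (B : 'M[PC]_(p, k)) : rowbd (rowdeg B) B.
Proof. by move=> i j; apply: leq_trans (leqSpred _); move: j; apply/mxsize_rowP. Qed.

Lemma rowdeg_le p k (e : 'I_p -> nat) (B : 'M[PC]_(p, k)) i :
  rowbd e B -> (rowdeg B i <= e i)%N.
Proof. by move=> h; rewrite -ltnS /rowdeg; case: (mxsize _) (introT (mxsize_rowP B i (e i).+1) (h i)). Qed.

Lemma ev_mul x m n p (A : 'M[PC]_(m, n)) (B : 'M_(n, p)) :
  ev x (A *m B) = ev x A *m ev x B.
Proof. exact: map_mxM. Qed.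

Lemma ev_tr x m n (A : 'M[PC]_(m, n)) : ev x A^T = (ev x A)^T.
Proof. by rewrite /ev map_trmx. Qed.

Lemma fracmx_inj m n : injective (@fracmx R m n).
Proof.
move=> A B /matrixP h; apply/matrixP => i j; have := h i j; rewrite !mxE.
by move/eqP; rewrite tofrac_eq => /eqP.
Qed.

Lemma fracmxM m n p (A : 'M[PC]_(m, n)) (B : 'M_(n, p)) :
  fracmx (A *m B) = fracmx A *m fracmx B.
Proof. exact: map_mxM. Qed.

Lemma fracmx_tr m n (A : 'M[PC]_(m, n)) : fracmx A^T = (fracmx A)^T.
Proof. by rewrite /fracmx map_trmx. Qed.

Lemma fracmx0 m n : fracmx (0 : 'M[PC]_(m, n)) = 0.
Proof. exact: map_mx0. Qed.

Lemma unit_noroot (p : PC) : (forall x, p.[x] != 0) -> p \is a GRing.unit.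
Proof.
move=> h; rewrite poly_unitE; have [/size_poly1P [c c0 ->]|] := boolP (size p == 1%N).
  by rewrite coefC unitfE c0.
by case/closed_rootP => x; rewrite rootE (negbTE (h x)).
Qed.

Lemma unit_root (p : PC) x : p \is a GRing.unit -> p.[x] != 0.
Proof.
rewrite poly_unitE => /andP [/size_poly1P [c c0 ->] _].
by rewrite hornerC.
Qed.

Lemma size_mul_unit (p q : PC) : q \is a GRing.unit -> size (p * q) = size p.
Proof.
rewrite poly_unitE => /andP [/size_poly1P [c c0 ->] _].
by rewrite mulrC mul_polyC size_scale.
Qed.

Lemma pw_free_unit n (A : 'M[PC]_n) : pw_free A -> A \in unitmx.
Proof.
move=> h; rewrite unitmxE; apply: unit_noroot => x.
have := h x; rewrite row_free_unit unitmxE unitfE.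
by rewrite -horner_evalE -det_map_mx.
Qed.

Lemma unit_pw_free n (A : 'M[PC]_n) : A \in unitmx -> pw_free A.
Proof.
rewrite unitmxE => h x; rewrite row_free_unit unitmxE unitfE.
by rewrite /ev det_map_mx; apply: unit_root.
Qed.

Lemma pw_free_mulr p n q (A : 'M[PC]_(p, n)) (V : 'M[PC]_(n, q)) :
  pw_free A -> pw_free V -> pw_free (A *m V).
Proof. by move=> hA hV x; rewrite ev_mul /row_free mxrankMfree //; apply: hA. Qed.

Lemma size_mul_bound (p q : PC) a b : (size p <= a.+1)%N -> (size q <= b.+1)%N ->
  (size (p * q)%R <= (a + b).+1)%N.
Proof.
move=> hp hq; apply: leq_trans (size_polyMleq _ _) _.
by lia.
Qed.

Lemma coef_mul_top (p q : PC) a b : (size p <= a.+1)%N -> (size q <= b.+1)%N ->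
  (p * q)`_(a + b) = p`_a * q`_b.
Proof.
move=> hp hq; rewrite coefM.
have ha : (a < (a + b).+1)%N by rewrite ltnS leq_addr.
rewrite (bigD1 (Ordinal ha)) //= addKn big1 ?addr0 // => j hj.
have [hja|hja] := ltnP a j; first by rewrite nth_default ?mul0r // (leq_trans hp).
rewrite [q`__]nth_default ?mulr0 // (leq_trans hq) //.
have ltja : (j < a)%N by rewrite ltn_neqAle hja andbT.
by lia.
Qed.

Lemma prod_top (I : finType) (f : I -> PC) (e : I -> nat) :
  (forall i, (size (f i) <= (e i).+1)%N) ->
  (size (\prod_i f i)%R <= (\sum_i e i).+1)%N /\
  (\prod_i f i)`_(\sum_i e i) = \prod_i (f i)`_(e i).
Proof.
move=> h.
elim/big_rec3: _ => [|i a b c _ [h1 h2]]; first by rewrite size_poly1 coefC.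
by split; [exact: size_mul_bound | rewrite coef_mul_top // h2].
Qed.

Lemma det_top n (M : 'M[PC]_n) (e : 'I_n -> nat) : rowbd e M ->
  (size (\det M) <= (\sum_i e i).+1)%N /\
  (\det M)`_(\sum_i e i) = \det (leadmx e M).
Proof.
move=> h; rewrite /determinant; split.
  apply: (leq_trans (size_sum _ _ _)); apply/bigmax_leqP => s _.
  rewrite -signr_odd; have [h1 _] := prod_top (fun i => h i (s i)).
  by case: (odd s) => /=; rewrite ?expr0 ?mul1r // expr1 mulN1r size_polyN.
rewrite coef_sum; apply: eq_bigr => s _.
have [_ h1] := prod_top (fun i => h i (s i)).
have -> : \prod_i leadmx e M i (s i) = \prod_i (M i (s i))`_(e i).
  by apply: eq_bigr => i _; rewrite mxE.
by rewrite -h1; case: (odd_perm s) => /=; rewrite ?expr0 ?mul1r // expr1 !mulN1r coefN.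
Qed.

(** Top terms cannot cancel: at the largest value of [size (T u i) + e i] over nonzero [T u i], the
    coefficient of the product is a nontrivial combination of the rows of the leading matrix. *)
Lemma predictable_degree p k (e : 'I_p -> nat) (B : 'M[PC]_(p, k)) q
    (T : 'M[PC]_(q, p)) u N :
  rowbd e B -> row_free (leadmx e B) ->
  (forall j, (size ((T *m B) u j) <= N)%N) ->
  forall i, T u i != 0 -> (size (T u i) + e i <= N)%N.
Proof.
move=> hb hl hN i0 hi0; rewrite leqNgt; apply/negP => hlt.
case: (@arg_maxnP _ i0 (fun i => T u i != 0) (fun i => size (T u i) + e i)%N hi0) => i1 hi1 hmax.
pose M := (size (T u i1) + e i1).-1%N.
have eM : (size (T u i1) + e i1 = M.+1)%N.
  by rewrite /M prednK // addn_gt0 size_poly_gt0 hi1.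
have NM : (N <= M)%N by rewrite -ltnS -eM; apply: leq_trans hlt (hmax _ hi0).
have hs i : (size (T u i) + e i <= M.+1)%N \/ T u i = 0.
  by have [->|hi] := eqVneq (T u i) 0; [right | left; rewrite -eM; apply: hmax].
(* Entry [i] of [v] is the coefficient that meets degree [e i] of row [i] in total degree [M].
   Truncation in [M - e i] is harmless, since [e i <= M] whenever [T u i] is nonzero. *)
pose v : 'rV[C]_p := \row_i (T u i)`_(M - e i).
have v0 : v = 0.
  apply: (row_free_inj hl); rewrite mul0mx; apply/rowP => j; rewrite !mxE.
  have := hN j => /leq_trans /(_ NM) hsz.
  have := nth_default 0 hsz; rewrite mxE coef_sum => e0; rewrite -[RHS]e0 {e0}.
  apply: eq_bigr => i _; rewrite !mxE.
  case: (hs i) => [hi|->]; last by rewrite !coef0 mul0r mul0r coef0.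
  have [->|Tn0] := eqVneq (T u i) 0; first by rewrite !coef0 mul0r mul0r coef0.
  have eiM : (e i <= M)%N.
    by rewrite -ltnS (leq_trans _ hi) // -{1}[e i]add0n ltn_add2r size_poly_gt0.
  rewrite -{2}(subnK eiM) coef_mul_top //.
  by rewrite -(leq_add2r (e i)) addSn subnK.
have /eqP := congr1 (fun w : 'rV_p => w 0 i1) v0; rewrite !mxE.
have -> : (M - e i1 = (size (T u i1)).-1)%N.
  by rewrite /M -subn1 subnAC addnK subn1.
by rewrite -lead_coefE lead_coef_eq0 (negbTE hi1).
Qed.

End Pointwise.

(** * Unimodular completion of pointwise free matrices *)

Section Completion.
Set Implicit Arguments. Unset Strict Implicit. Unset Printing Implicit Defensive.
Import Order.TTheory GRing.Theory Num.Theory.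
Local Open Scope ring_scope.
Variable R : realType.
Local Notation C := R[i].
Local Notation PC := {poly C}.
Local Notation FC := {fraction {poly C}}.
Local Notation "x %:F" := (@tofrac _ x).

Lemma row_freeP0 (F : fieldType) m n (A : 'M[F]_(m, n)) :
  row_free A <-> (forall u : 'rV_m, u *m A = 0 -> u = 0).
Proof.
split=> [h u u0|]; last exact: inj_row_free.
by apply: (row_free_inj h); rewrite u0 mul0mx.
Qed.

Lemma row_freePN (F : fieldType) m n (A : 'M[F]_(m, n)) :
  ~~ row_free A -> exists2 u : 'rV_m, u != 0 & u *m A = 0.
Proof.
rewrite -kermx_eq0 => /rowV0Pn [u /sub_kermxP u0 un0]; by exists u.
Qed.

Lemma elementary_unitmx n (q : PC) (k j : 'I_n) : k != j ->
  1%:M + q *: delta_mx k j \in unitmx.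
Proof.
move=> kj; have : (1%:M + q *: delta_mx k j) *m (1%:M - q *: delta_mx k j) = 1%:M.
  rewrite mulmxDl !mulmxBr !mulmx1 !mul1mx -scalemxAl -scalemxAr.
  by rewrite mul_delta_mx_0 1?eq_sym // !scaler0 subr0 subrK.
by move/mulmx1_unit => [h _]; exact: h.
Qed.

(** Euclidean division by column operations: as long as two entries are nonzero, replacing the
    larger by its remainder lowers the total size. *)
Lemma row_reduce n (b : 'rV[PC]_(1 + n)) : exists g (V : 'M[PC]_(1 + n)),
  V \in unitmx /\ b *m V = row_mx g%:M 0.
Proof.
have [N] := ubnP (\sum_j size (b ord0 j))%N; elim: N b => // N IH b hN.
have [|hb] := boolP [exists j, exists k, [&& j != k, b 0 j != 0, b 0 k != 0 &
    (size (b ord0 k) <= size (b ord0 j))%N]].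
  case/existsP => j /existsP [k /and4P [jk bj bk le]].
  pose V0 : 'M[PC]_(1 + n) := 1%:M + (- (b 0 j %/ b 0 k)) *: delta_mx k j.
  have uV0 : V0 \in unitmx by apply: elementary_unitmx; rewrite eq_sym.
  have eV0 l : (b *m V0) 0 l = if l == j then b 0 j %% b 0 k else b 0 l.
    rewrite mulmxDr mulmx1 -scalemxAr mxE [(_ *: (b *m _)) 0 l]mxE [(b *m _) 0 l]mxE.
    rewrite (bigD1 k) //= big1 ?addr0 => [|x xk]; last by rewrite mxE (negbTE xk) mulr0.
    rewrite mxE eqxx /=; case: eqP => [->|_]; last by rewrite !mulr0 addr0.
    by rewrite mulr1 mulNr {1}(divp_eq (b 0 j) (b 0 k)) addrAC subrr add0r.
  have [|g [V [uV eV]]] := IH (b *m V0).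
    rewrite ltnS in hN; apply: leq_trans hN.
    rewrite (bigD1 j) //= [X in (_ < X)%N](bigD1 j) //= eV0 eqxx.
    rewrite (eq_bigr (fun l => size (b 0 l))) => [|l lj]; last by rewrite eV0 (negbTE lj).
    by rewrite ltn_add2r (leq_trans _ le) // ltn_modp.
  by exists g, (V0 *m V); rewrite unitmx_mul uV0 uV mulmxA.
have [->|/rV0Pn [j bj]] := eqVneq b 0.
  by exists 0, 1%:M; rewrite unitmx1 mulmx1 raddf0 row_mx0.
have hz k : k != j -> b 0 k = 0.
  move=> kj; apply/eqP; apply: contraNT hb => bk.
  have [le|le] := leqP (size (b 0 k)) (size (b 0 j)).
    by apply/existsP; exists j; apply/existsP; exists k; rewrite eq_sym kj bj bk.
  by apply/existsP; exists k; apply/existsP; exists j; rewrite kj bj bk ltnW.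
exists (b 0 j), (tperm_mx 0 j); split; first exact: unitmx_perm.
rewrite -xcolE; apply/rowP => l; rewrite !mxE; case: splitP => l' el; rewrite !mxE.
  have -> : l = 0 by apply: val_inj; rewrite /= el ord1.
  by rewrite ord1 eqxx tpermL.
apply: hz; apply/eqP => h.
have : tperm 0 j l = tperm 0 j 0 by rewrite h tpermL.
by move/perm_inj => l0; rewrite l0 in el.
Qed.

Lemma pid_mx_succ (A : pzSemiRingType) p n :
  block_mx 1%:M 0 0 (pid_mx p) = pid_mx p.+1 :> 'M[A]_(1 + p, 1 + n).
Proof.
apply/matrixP => i j; rewrite !mxE; case: splitP => i' ei; rewrite !mxE;
 case: splitP => j' ej; rewrite !mxE ei ej ?ord1 //= ?eqSS //.
Qed.

(** A root of the pivot [g] would annihilate the first row at a point, so [g] is a unit because C is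
    algebraically closed; the lower right block is again pointwise free and induction applies. *)
Lemma pw_free_completion p n (B : 'M[PC]_(p, n)) : pw_free B ->
  exists2 V : 'M[PC]_n, V \in unitmx & B *m V = pid_mx p.
Proof.
elim: p n B => [|p IH] n B hB.
  by exists 1%:M; rewrite ?unitmx1 // [LHS]flatmx0 [RHS]flatmx0.
case: n B hB => [|n] B hB.
  by have := rank_leq_col (ev 0 B); rewrite (eqP (hB 0)).
have [g [V1 [uV1]]] := row_reduce (usubmx (B : 'M_(1 + p, 1 + n))).
rewrite mul_usub_mx => e1.
set B1 := (B : 'M_(1 + p, 1 + n)) *m V1 in e1.
have hB1 : pw_free B1 by apply: pw_free_mulr => //; apply: unit_pw_free.
pose c := lsubmx (dsubmx B1); pose B' := rsubmx (dsubmx B1).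
have eB1 : B1 = block_mx g%:M 0 c B'.
  by rewrite -[LHS]vsubmxK e1 /block_mx /c /B' hsubmxK.
have g0 x : g.[x] != 0.
  apply/eqP => gx; have /row_freeP0 /(_ (row_mx 1%:M 0)) := hB1 x.
  rewrite eB1 /ev (map_block_mx (horner_eval x)) mul_row_block !mul1mx !mul0mx !addr0 map_mx0.
  rewrite map_scalar_mx /= /horner_eval gx raddf0 row_mx0 => /(_ erefl).
  move=> h; have /matrixP /(_ 0 0) /eqP := congr1 lsubmx h.
  by rewrite row_mxKl !mxE eqxx oner_eq0.
have ug : g \is a GRing.unit by apply: unit_noroot.
have hB' : pw_free B'.
  (* The first coordinate is chosen so that the extended vector also cancels the column [c]. *)
  move=> x; apply/row_freeP0 => u u0; have /row_freeP0 /(_ (row_mx (- (g.[x])^-1 *: (u *m ev x c)) u)) := hB1 x.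
  rewrite eB1 /ev (map_block_mx (horner_eval x)) mul_row_block map_mx0 mulmx0 add0r u0.
  rewrite map_scalar_mx /= -[horner_eval x g]/(g.[x]) mul_mx_scalar scalerA mulrN divff // scaleN1r addNr row_mx0.
  by move=> /(_ erefl) h; have := congr1 rsubmx h; rewrite row_mxKr linear0.
have [V2 uV2 eV2] := IH _ _ hB'.
have pn : (p <= n)%N by have := rank_leq_col (ev 0 B'); rewrite (eqP (hB' 0)).
pose W2 : 'M[PC]_(1 + n) := block_mx 1%:M 0 0 V2.
(* [W3] normalises the pivot to 1 and clears [c], using the identity block that [V2] has produced
   beneath. *)
pose W3 : 'M[PC]_(1 + n) := block_mx (g^-1)%:M 0 (- (pid_mx p *m c *m (g^-1)%:M)) 1%:M.
have uW2 : W2 \in unitmx by rewrite unitmxE det_ublock det1 mul1r -unitmxE.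
have uW3 : W3 \in unitmx by rewrite unitmxE det_lblock det1 mulr1 det_scalar1 unitrV.
exists (V1 *m W2 *m W3); first by rewrite unitmx_mul uW3 andbT unitmx_mul uV1 uW2.
transitivity (B1 *m W2 *m W3); first by rewrite /B1 -!mulmxA.
rewrite eB1 !mulmx_block !mulmx1 !mulmx0 !mul0mx !addr0 !add0r eV2.
rewrite mul0mx addr0 mulmxN !mulmxA pid_mx_id // pid_mx_1 mul1mx subrr.
by rewrite -scalar_mxM mulrV // pid_mx_succ.
Qed.

Lemma pw_free_right_inverse p n (B : 'M[PC]_(p, n)) : pw_free B ->
  exists D : 'M[PC]_(n, p), B *m D = 1%:M.
Proof.
move=> hB; have [V uV eV] := pw_free_completion hB.
have pn : (p <= n)%N by have := rank_leq_col (ev 0 B); rewrite (eqP (hB 0)).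
by exists (V *m pid_mx p); rewrite mulmxA eV pid_mx_id // pid_mx_1.
Qed.

Lemma pw_free_fracmx p n (B : 'M[PC]_(p, n)) : pw_free B -> row_free (fracmx B).
Proof.
move=> /pw_free_right_inverse [D eD]; apply/row_freeP; exists (fracmx D).
by rewrite -fracmxM eD /fracmx map_mx1.
Qed.

(** Multiplying a rational relation [B' = S B] by a polynomial right inverse of [B] shows that [S]
    itself is polynomial. *)
Lemma pw_free_factor p q k (B : 'M[PC]_(p, k)) (B' : 'M[PC]_(q, k)) :
  pw_free B -> (fracmx B' <= fracmx B)%MS -> exists T : 'M[PC]_(q, p), B' = T *m B.
Proof.
move=> /pw_free_right_inverse [D eD] /submxP [S eS].
exists (B' *m D); apply: (@fracmx_inj R); rewrite !fracmxM eS -!mulmxA.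
by rewrite [fracmx B *m _]mulmxA -fracmxM eD /fracmx map_mx1 mul1mx.
Qed.

(** * Minimal bases: characterization by ranks, and existence *)

Lemma rowdeg_reduced p k (e : 'I_p -> nat) (B : 'M[PC]_(p, k)) :
  rowbd e B -> row_free (leadmx e B) -> forall i, mxsize (row i B) = (e i).+1.
Proof.
move=> hb hl i; apply/eqP; rewrite eqn_leq; apply/andP; split.
  by apply/mxsize_rowP => j; apply: hb.
rewrite ltnNge; apply/negP => /mxsize_rowP h.
have /row_freeP0 /(_ (delta_mx 0 i)) := hl.
rewrite -rowE => H; have /H : row i (leadmx e B) = 0.
  by apply/rowP => j; rewrite !mxE nth_default ?h.
by move/rowP/(_ i)/eqP; rewrite !mxE !eqxx oner_eq0.
Qed.

(** Another basis has the form [T *m B] with [\det T] nonzero. A nonzero term of that determinant is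
    a permutation matching each row of [B'] with a row of [B] whose degree, by predictability, is no
    larger. *)
Lemma reduced_minimal p k (e : 'I_p -> nat) (B : 'M[PC]_(p, k)) :
  rowbd e B -> row_free (leadmx e B) -> pw_free B -> is_minimal_basis B.
Proof.
move=> hb hl hB; have fB := pw_free_fracmx hB.
split; first by rewrite /poly_basis_of fB submx_refl.
move=> B' /andP [fB' /andP [sB' _]].
have [T eT] := pw_free_factor hB sB'.
have fT : fracmx T \in unitmx.
  rewrite -row_free_unit /row_free eqn_leq rank_leq_row /=.
  by rewrite -{1}(eqP fB') eT fracmxM mxrankM_maxl.
have dT : \det T != 0.
  apply/eqP => d0; move: fT; rewrite unitmxE /fracmx det_map_mx d0.
  by rewrite rmorph0 unitr0.
have [s hs] : exists s : {perm 'I_p}, forall i, T i (s i) != 0.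
  apply: contrapT => hN; case/eqP: dT; rewrite /determinant big1 // => s _.
  have [i hi] : exists i, ~ (T i (s i) != 0).
    by apply/existsNP => h; apply: hN; exists s.
  by rewrite (bigD1 i) //= (eqP (negbNE (introN idP hi))) mul0r mulr0.
rewrite /sumdeg (reindex_inj (@perm_inj _ s)) /=; apply: leq_sum => i _.
apply: leq_trans (rowdeg_le _ hb) _; rewrite -ltnS.
have hz j : (size ((T *m B) i j) <= (rowdeg B' i).+1)%N by rewrite -eT rowbd_rowdeg.
apply: leq_trans (predictable_degree hb hl hz (hs i)).
by rewrite -[X in (X < _)%N]add0n ltn_add2r size_poly_gt0.
Qed.

Lemma minimal_row_gt0 p k (B : 'M[PC]_(p, k)) i : row_free (fracmx B) ->
  mxsize (row i B) = (rowdeg B i).+1.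
Proof.
move=> fB; rewrite /rowdeg prednK // lt0n; apply/negP => /eqP h0.
have /mxsize_rowP h : (mxsize (row i B) <= 0)%N by rewrite h0.
have /row_freeP0 /(_ (delta_mx 0 i)) := fB.
rewrite -rowE => H; have /H : row i (fracmx B) = 0.
  apply/rowP => j; rewrite !mxE; have := h j; rewrite leqn0 size_poly_eq0 => /eqP ->.
  by rewrite rmorph0.
by move/rowP/(_ i)/eqP; rewrite !mxE !eqxx oner_eq0.
Qed.

(* Exchange: a basis row may be replaced by any combination that involves it. *)
Lemma minimal_exchange q p k (S : 'M[FC]_(q, k)) (B : 'M[PC]_(p, k))
    (w : 'rV[FC]_p) (v : 'rV[PC]_k) i :
  minimal_basis_of S B -> fracmx v = w *m fracmx B -> w 0 i != 0 ->
  (mxsize (row i B) <= mxsize v)%N.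
Proof.
move=> [/andP [fB eB] hmin] ev wi.
pose B' : 'M[PC]_(p, k) := \matrix_(j, l) if j == i then v 0 l else B j l.
pose T : 'M[FC]_p := \matrix_(j, l) if j == i then w 0 l else (j == l)%:R.
have eT : fracmx B' = T *m fracmx B.
  apply/matrixP => j l; rewrite !mxE; case: (eqVneq j i) => [ji|ji].
    have /rowP /(_ l) := ev; rewrite !mxE => ->; apply: eq_bigr => x _.
    by rewrite !mxE ji eqxx.
  rewrite (bigD1 j) //= big1 ?addr0 => [|x xj]; rewrite !mxE (negbTE ji).
    by rewrite eqxx mul1r.
  by rewrite eq_sym (negbTE xj) mul0r.
have uT : T \in unitmx.
  rewrite -row_free_unit; apply/row_freeP0 => u u0.
  have ui : u 0 i = 0.
    have /rowP /(_ i) := u0; rewrite !mxE (bigD1 i) //= big1 ?addr0 => [|x xi].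
      by rewrite !mxE eqxx => /eqP; rewrite mulf_eq0 (negbTE wi) orbF => /eqP.
    by rewrite mxE (negbTE xi) mulr0.
  apply/rowP => j; rewrite mxE; have [-> //|ji] := eqVneq j i.
  have /rowP /(_ j) := u0; rewrite !mxE (bigD1 j) //= big1 ?addr0 => [|x xj].
    by rewrite !mxE (negbTE ji) eqxx mulr1.
  by rewrite mxE; case: eqP => [->|_]; rewrite ?ui ?mul0r // (negbTE xj) mulr0.
have fB' : row_free (fracmx B') by rewrite eT /row_free mxrankMfree // -/(row_free T) row_free_unit.
have pB' : poly_basis_of S B'.
  rewrite /poly_basis_of fB' /=; apply/eqmxP; apply: eqmx_trans (eqmxP eB).
  by rewrite eT; apply: eqmxMfull; rewrite row_full_unit.
have := hmin _ pB'; rewrite /sumdeg (bigD1 i) //= [X in (_ <= X)%N](bigD1 i) //=.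
have -> : (\sum_(j < p | j != i) rowdeg B' j = \sum_(j < p | j != i) rowdeg B j)%N.
  apply: eq_bigr => j ji; rewrite /rowdeg; congr (mxsize _).-1.
  by apply/rowP => l; rewrite !mxE (negbTE ji).
have eBv : row i B' = v by apply/rowP => l; rewrite !mxE eqxx.
have := minimal_row_gt0 i fB'; have := minimal_row_gt0 i fB.
by rewrite leq_add2r /rowdeg eBv; lia.
Qed.

Lemma size_top_coef0 (p : PC) N : (size p <= N.+1)%N -> p`_N = 0 -> (size p <= N)%N.
Proof.
move=> h h0; rewrite leqNgt; apply/negP => lt.
have e : size p = N.+1 by apply/eqP; rewrite eqn_leq h.
have : lead_coef p = 0 by rewrite lead_coefE e.
by move/eqP; rewrite lead_coef_eq0 => /eqP p0; rewrite p0 size_poly0 in e.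
Qed.

(** Given a dependency of the leading rows, monomial multiples align the rows involved with the one
    of largest degree; the top coefficients cancel, and the shorter combination could be exchanged
    for that row. *)
Lemma minimal_reduced q p k (S : 'M[FC]_(q, k)) (B : 'M[PC]_(p, k)) :
  minimal_basis_of S B -> row_free (leadmx (rowdeg B) B).
Proof.
move=> hm; have [/andP [fB eB] _] := hm.
case: (boolP (row_free _)) => // /row_freePN [u u0 hu].
have [i0 hi0] : exists i, u 0 i != 0 by apply/rV0Pn.
case: (@arg_maxnP _ i0 (fun i => u 0 i != 0) (rowdeg B) hi0) => i hi hmax.
pose c j : PC := u 0 j *: 'X^(rowdeg B i - rowdeg B j).
pose v : 'rV[PC]_k := (\row_j c j) *m B.
have := @minimal_exchange _ _ _ S B (\row_j (c j)%:F) v i hm.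
rewrite leqNgt => H; have /negP [] : ~~ (mxsize v < mxsize (row i B))%N.
  apply: H.
  - by rewrite fracmxM; congr (_ *m _); apply/rowP => j; rewrite !mxE.
  - by rewrite mxE tofrac_eq0 /c -size_poly_eq0 size_scale // size_polyXn.
rewrite (minimal_row_gt0 i fB) ltnS; apply/mxsizeP => a l; rewrite ord1 {a}.
have hc j : (size (c j * B j l)%R <= (rowdeg B i).+1)%N /\
            (c j * B j l)`_(rowdeg B i) = u 0 j * (leadmx (rowdeg B) B) j l.
  rewrite /c mxE; have [->|uj] := eqVneq (u 0 j) 0.
    by rewrite scale0r !mul0r size_poly0 coef0.
  have le := hmax j uj; rewrite -scalerAl size_scale // coefZ.
  have hX : (size ('X^(rowdeg B i - rowdeg B j) : PC) <= (rowdeg B i - rowdeg B j).+1)%N.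
    by rewrite size_polyXn.
  have e : (rowdeg B i = (rowdeg B i - rowdeg B j) + rowdeg B j)%N by rewrite subnK.
  split; first by rewrite {2}e; apply: size_mul_bound => //; apply: rowbd_rowdeg.
  by rewrite {2}e coef_mul_top //; [rewrite coefXn eqxx mul1r | apply: rowbd_rowdeg].
apply: size_top_coef0.
  rewrite mxE; apply: (leq_trans (size_sum _ _ _)); apply/bigmax_leqP => j _.
  by rewrite mxE; case: (hc j).
rewrite mxE coef_sum; transitivity ((u *m leadmx (rowdeg B) B) 0 l); last by rewrite hu mxE.
by rewrite mxE; apply: eq_bigr => j _; rewrite mxE; case: (hc j).
Qed.

(** A dependency at the point [x] makes a constant combination of rows divisible by ['X - x%:P]; the
    quotient is shorter than the largest row involved and could be exchanged for it. *)
Lemma minimal_pw_free q p k (S : 'M[FC]_(q, k)) (B : 'M[PC]_(p, k)) :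
  minimal_basis_of S B -> pw_free B.
Proof.
move=> hm x; have [/andP [fB eB] _] := hm.
case: (boolP (row_free _)) => // /row_freePN [u u0 hu].
have [i0 hi0] : exists i, u 0 i != 0 by apply/rV0Pn.
case: (@arg_maxnP _ i0 (fun i => u 0 i != 0) (rowdeg B) hi0) => i hi hmax.
pose z : 'rV[PC]_k := (\row_j (u 0 j)%:P) *m B.
pose v : 'rV[PC]_k := \row_j (z 0 j %/ ('X - x%:P)).
have zv j : z 0 j = v 0 j * ('X - x%:P).
  rewrite [v 0 j]mxE divpK // dvdp_XsubCl rootE mxE.
  have /rowP /(_ j) := hu; rewrite mxE [RHS]mxE => e0; rewrite -[X in _ == X]e0 horner_sum; apply/eqP.
  by apply: eq_bigr => l _; rewrite !mxE hornerM hornerC.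
have Xn0 : ('X - x%:P : PC) != 0 by rewrite polyXsubC_eq0.
have := @minimal_exchange _ _ _ S B (\row_j ((u 0 j)%:P%:F / ('X - x%:P)%:F)) v i hm.
rewrite leqNgt => H; have /negP [] : ~~ (mxsize v < mxsize (row i B))%N.
  apply: H.
  - apply/rowP => j; apply: (@mulIf _ ('X - x%:P)%:F); first by rewrite tofrac_eq0.
  have -> : fracmx v 0 j = (v 0 j)%:F by rewrite mxE.
  rewrite -tofracM -zv mxE rmorph_sum [in RHS]mxE mulr_suml; apply: eq_bigr => l _.
  by rewrite !mxE rmorphM /= [RHS]mulrAC divfK ?tofrac_eq0.
  - by rewrite mxE mulf_neq0 ?invr_eq0 ?tofrac_eq0 // polyC_eq0.
rewrite (minimal_row_gt0 i fB) ltnS; apply/mxsizeP => a l; rewrite ord1 {a}.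
have hz : (size (z ord0 l) <= (rowdeg B i).+1)%N.
  rewrite mxE; apply: (leq_trans (size_sum _ _ _)); apply/bigmax_leqP => j _.
  rewrite mxE mul_polyC; have [->|uj] := eqVneq (u 0 j) 0; first by rewrite scale0r size_poly0.
  rewrite size_scale //; apply: leq_trans (rowbd_rowdeg _ _ _) _.
  by rewrite ltnS; apply: hmax.
have [->|vn] := eqVneq (v 0 l) 0; first by rewrite size_poly0.
by move: hz; rewrite zv size_Mmonic ?monicXsubC // size_XsubC addn2.
Qed.

Lemma frac_clear (x : FC) : exists n d : PC, d != 0 /\ d%:F * x = n%:F.
Proof.
elim/quotW: x => x; exists (\n_x), (\d_x); split; first exact: denom_ratioP.
(* On representatives the equality in the quotient becomes an identity of cross products. *)
rewrite -[LHS]/(FracField.mul _ _) !piE; apply/eqmodP.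
rewrite /= FracField.equivfE /FracField.mulf.
rewrite !numden_Ratio ?(oner_eq0, mulf_neq0, denom_ratioP) //.
by rewrite mulr1 mul1r.
Qed.

Lemma fracs_clear (I : finType) (f : I -> FC) :
  exists (d : PC) (g : I -> PC), d != 0 /\ forall i, d%:F * f i = (g i)%:F.
Proof.
have H i := frac_clear (f i).
have [n hn] := choice H; have [d hd] := choice hn.
exists (\prod_i d i), (fun i => (\prod_(j | j != i) d j) * n i); split.
  by apply/prodf_neq0 => i _; case: (hd i).
move=> i; rewrite (bigD1 i) //= !rmorphM /= -(proj2 (hd i)).
by rewrite [_%:F * _%:F * _]mulrAC mulrC.
Qed.

Lemma poly_basis_exists q k (S : 'M[FC]_(q, k)) :
  exists B : 'M[PC]_(\rank S, k), poly_basis_of S B.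
Proof.
have [d [g [d0 hg]]] := fracs_clear (fun ij : 'I_(\rank S) * 'I_k => row_base S ij.1 ij.2).
pose B : 'M[PC]_(\rank S, k) := \matrix_(i, j) g (i, j).
have eB : fracmx B = d%:F *: row_base S.
  by apply/matrixP => i j; rewrite mxE [B i j]mxE [RHS]mxE -hg.
exists B; rewrite /poly_basis_of /row_free eB; have dF : d%:F != 0 by rewrite tofrac_eq0.
rewrite (eqmx_scale _ dF) -/(row_free _) row_base_free /=; apply/eqmxP.
exact: eqmx_trans (eqmx_scale _ dF) (eq_row_base S).
Qed.

Lemma minimal_basis_exists q k (S : 'M[FC]_(q, k)) :
  exists B : 'M[PC]_(\rank S, k), minimal_basis_of S B.
Proof.
have [B0 hB0] := poly_basis_exists S.
have [N] := ubnP (sumdeg B0); elim: N B0 hB0 => // N IH B hB hN.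
have [[B' [hB' lt]]|nB] := EM (exists B' : 'M[PC]_(\rank S, k), poly_basis_of S B' /\ (sumdeg B' < sumdeg B)%N).
  by apply: (IH B' hB'); apply: leq_trans lt _; rewrite -ltnS.
exists B; split=> // B' hB'; rewrite leqNgt; apply/negP => lt.
by apply: nB; exists B'.
Qed.

Lemma poly_basis_rank q p k (S : 'M[FC]_(q, k)) (B : 'M[PC]_(p, k)) :
  poly_basis_of S B -> p = \rank S.
Proof. by move=> /andP [/eqP fB /eqmxP eB]; rewrite -fB eB. Qed.

End Completion.

(** * Degree sums of dual bases, and the inclusion of O_a in A_a *)

Section Duality.
Set Implicit Arguments. Unset Strict Implicit. Unset Printing Implicit Defensive.
Import Order.TTheory GRing.Theory Num.Theory.
Local Open Scope ring_scope.
Variable R : realType.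
Local Notation C := R[i].
Local Notation PC := {poly C}.
Local Notation FC := {fraction {poly C}}.

Lemma row_free_complete (F : fieldType) p q (A : 'M[F]_(p, p + q)) : row_free A ->
  exists K : 'M[F]_(q, p + q), col_mx A K \in unitmx.
Proof.
move=> /eqP fA; have := mulmx_ebase A; rewrite fA => eA.
exists (dsubmx (row_ebase A)).
have -> : col_mx A (dsubmx (row_ebase A)) = block_mx (col_ebase A) 0 0 1%:M *m row_ebase A.
  rewrite -{2}[row_ebase A]vsubmxK mul_block_col !mul0mx addr0 add0r mul1mx.
  congr col_mx; rewrite -{1}eA -mulmxA; congr (_ *m _).
  by rewrite pid_mx_row -{1}[row_ebase A]vsubmxK mul_row_col mul1mx mul0mx addr0.
by rewrite unitmx_mul row_ebase_unit andbT unitmxE det_ublock det1 mulr1 -unitmxE col_ebase_unit.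
Qed.

Definition split_fun p q (T : Type) (f : 'I_p -> T) (g : 'I_q -> T) (i : 'I_(p + q)) : T :=
  match split i with inl j => f j | inr j => g j end.

(* Completing B by constant rows K to a reduced square matrix, and B to a
   unimodular one, det [B; K] and det (K N^T) agree up to a unit. *)
Lemma dual_sum_le p q n (e : 'I_p -> nat) (B : 'M[PC]_(p, n)) (eN : 'I_q -> nat)
    (N : 'M[PC]_(q, n)) :
  n = (p + q)%N -> rowbd e B -> row_free (leadmx e B) -> pw_free B ->
  rowbd eN N -> pw_free N -> B *m N^T = 0 ->
  (\sum_i e i <= \sum_i eN i)%N.
Proof.
move=> en; subst n => hb hl hB hbN hN BN0.
have [V uV eV] := pw_free_completion hB.
have [K uK] := row_free_complete hl.
pose K' : 'M[PC]_(q, p + q) := map_mx polyC K.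
pose Y := invmx V *m N^T.
have eN' : N^T = V *m Y by rewrite /Y mulKVmx.
have Yu : usubmx Y = 0.
  have : B *m N^T = 0 := BN0.
  rewrite eN' mulmxA eV pid_mx_row -{1}[Y]vsubmxK mul_row_col mul1mx mul0mx addr0 //.
pose Z := dsubmx Y.
have eY : Y = col_mx 0 Z by rewrite -[LHS]vsubmxK Yu.
(* A point where [Z] is singular would be a point where the rows of [N] are dependent; so the
   determinant has no root. *)
have uZ : \det Z \is a GRing.unit.
  rewrite -unitmxE -unitmx_tr; apply: pw_free_unit => x.
  apply/row_freeP0 => u u0; have /row_freeP0 := hN x; apply.
  have -> : N = Y^T *m V^T by rewrite -trmx_mul -eN' trmxK.
  rewrite ev_mul mulmxA eY tr_col_mx trmx0.
  have -> : ev x (row_mx (0 : 'M_(q, p)) Z^T) = row_mx 0 (ev x Z^T).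
    by rewrite /ev (map_row_mx (horner_eval x)) map_mx0.
  by rewrite mul_mx_row u0 mulmx0 row_mx0 mul0mx.
have eD : \det (col_mx B K') * \det V * \det Z = \det (N *m K'^T).
  rewrite -det_mulmx mul_col_mx eV pid_mx_row -[K' *m V]hsubmxK -/(block_mx _ _ _ _) det_lblock det1 mul1r.
  rewrite -[RHS]det_tr trmx_mul trmxK -det_mulmx; congr (\det _).
  rewrite eN' mulmxA eY -{2}[K' *m V]hsubmxK mul_row_col mulmx0 add0r //.
pose e' := split_fun e (fun _ : 'I_q => 0%N).
have he' : rowbd e' (col_mx B K').
  move=> i j; rewrite /e' /split_fun mxE; case: splitP => k _; first exact: hb.
  by rewrite mxE size_polyC leq_b1.
have se' : (\sum_i e' i = \sum_i e i)%N.
  rewrite big_split_ord /= [X in (_ + X)%N]big1 ?addn0 => [|i _].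
    by apply: eq_bigr => i _; rewrite /e' /split_fun (unsplitK (inl i)).
  by rewrite /e' /split_fun (unsplitK (inr i)).
have le' : leadmx e' (col_mx B K') = col_mx (leadmx e B) K.
  apply/matrixP => i j; rewrite !mxE /e' /split_fun; case: splitP => k _; rewrite !mxE //.
  by rewrite coefC eqxx.
have [h1 h2] := det_top he'.
(* The coefficient in degree [\sum_i e i] is the determinant of the constant matrix formed by
   [leadmx e B] and [K], which is nonzero. The other determinant, with [K'] constant, has degree at
   most [\sum_i eN i]. *)
have s1 : (\sum_i e i < size (\det (col_mx B K')))%N.
  rewrite ltnNge -se'; apply/negP => h; move: h2; rewrite nth_default // le' => /esym/eqP.
  by apply/negP; rewrite -unitfE -unitmxE.
rewrite -ltnS; apply: (leq_trans s1).
have hz : rowbd eN (N *m K'^T).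
  move=> i j; rewrite mxE; apply: (leq_trans (size_sum _ _ _)); apply/bigmax_leqP => l _.
  rewrite !mxE -[(eN i)]addn0; apply: size_mul_bound; first exact: hbN.
  by rewrite size_polyC leq_b1.
have [h3 _] := det_top hz; apply: leq_trans h3.
by rewrite -eD !size_mul_unit // -unitmxE.
Qed.

Lemma minimal_indicesP q k (S : 'M[FC]_(q, k)) s : minimal_indices S s ->
  exists B : 'M[PC]_(\rank S, k), [/\ minimal_basis_of S B,
    perm_eq [seq rowdeg B i | i <- enum 'I_(\rank S)] s & sumdeg B = sumn s].
Proof.
case=> p [B [hB hs]]; have ep := poly_basis_rank (proj1 hB); subst p.
exists B; split=> //; rewrite -(perm_sumn hs) /sumdeg.
by rewrite sumnE big_map big_enum.
Qed.

Lemma balanced_sum a c : (0 < c)%N ->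
  sumn (nseq (a %% c) (a %/ c).+1 ++ nseq (c - a %% c) (a %/ c))%N = a.
Proof.
move=> c0; rewrite sumn_cat !sumn_nseq {5}(divn_eq a c).
have := ltn_pmod a c0; nia.
Qed.

Lemma sum_tight r d (f : 'I_r -> nat) : (forall i, f i <= d)%N ->
  (r * d <= \sum_i f i)%N -> forall i, f i = d.
Proof.
move=> hf hs i; apply/eqP; rewrite eqn_leq hf /= leqNgt; apply/negP => lt.
move: hs; rewrite leqNgt => /negP; apply.
have -> : (r * d = \sum_(j < r) d)%N by rewrite sum_nat_const card_ord.
rewrite (bigD1 i) //= [X in (_ < X)%N](bigD1 i) //= -addSn; apply: leq_add => //.
exact: leq_sum.
Qed.

Lemma rank_rnull m n (A : 'M[PC]_(m, n)) : \rank (rnull A) = (n - normal_rank A)%N.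
Proof. by rewrite /rnull mxrank_ker mxrank_tr. Qed.

Lemma rank_lnull m n (A : 'M[PC]_(m, n)) : \rank (lnull A) = (m - normal_rank A)%N.
Proof. by rewrite /lnull mxrank_ker. Qed.

Lemma lnull_basis_mul q m n (A : 'M[PC]_(m, n)) (N : 'M[PC]_(q, m)) :
  poly_basis_of (lnull A) N -> N *m A = 0.
Proof.
move=> /andP [_ /andP [/sub_kermxP h _]]; apply: (@fracmx_inj R).
by rewrite fracmxM fracmx0 h.
Qed.

Lemma rnull_basis_mul q m n (A : 'M[PC]_(m, n)) (N : 'M[PC]_(q, n)) :
  poly_basis_of (rnull A) N -> A *m N^T = 0.
Proof.
move=> /andP [_ /andP [/sub_kermxP h _]]; apply: trmx_inj; apply: (@fracmx_inj R).
by rewrite trmx_mul trmxK fracmxM fracmx_tr h trmx0 fracmx0.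
Qed.

Lemma pw_free_cancel p q k (A : 'M[PC]_(q, p)) (B : 'M[PC]_(p, k)) :
  pw_free B -> A *m B = 0 -> A = 0.
Proof.
by move=> /pw_free_right_inverse [D eD] h; rewrite -[A]mulmx1 -eD mulmxA h mul0mx.
Qed.

Lemma diag_seq1 m n r : diag_seq m n (nseq r 1) = pid_mx r :> 'M[PC]_(m, n).
Proof.
apply/matrixP => i j; rewrite !mxE size_nseq.
by case: ifP => // /andP [_ ir]; rewrite nth_nseq ir.
Qed.

Lemma trivial_invariants_rank m n r (P : 'M[PC]_(m, n)) x :
  invariant_polys P (nseq r 1) -> \rank (ev x P) = r.
Proof.
case; rewrite size_nseq leq_min => /andP [rm rn] _ _ [U [V [uU uV]]].
rewrite diag_seq1 => e; have := congr1 (fun M => \rank (ev x M)) e.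
rewrite !ev_mul mxrankMfree; last by apply: unit_pw_free; rewrite unitmxE.
rewrite eqmxMfull; last first.
  by rewrite row_full_unit -row_free_unit; apply: unit_pw_free; rewrite unitmxE.
by rewrite /ev map_pid_mx rank_pid_mx.
Qed.

Lemma mxsize_col m n (A : 'M[PC]_(m, n)) i : mxsize (col i A) = mxsize (row i A^T).
Proof. by rewrite -tr_col mxsize_tr. Qed.

Lemma Oset_sub_Aset m n r d a : (0 < r)%N -> (r < minn m n)%N -> (a <= r * d)%N ->
  psubset (Oset R m n r d a) (Aset R m n r d a).
Proof.
move=> r0; rewrite leq_min => /andP [rm rn] ard P [[hsz hrk] hinv _ hleft hright].
have [R' hR'] : exists R' : 'M[PC]_(r, n), minimal_basis_of (fracmx P) R'.
  by have := minimal_basis_exists (fracmx P); rewrite -/(normal_rank P) hrk.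
have pR := minimal_pw_free hR'; have lR := minimal_reduced hR'.
have bR := rowbd_rowdeg R'.
have [L eP] : exists L, P = L *m R'.
  by apply: pw_free_factor => //; case: hR' => /andP [_ /andP []].
(* With all invariant polynomials equal to 1, [P] has rank [r] at every point, and this rank cannot
   exceed that of [L] there. *)
have pL : pw_free L^T.
  move=> x; rewrite /row_free ev_tr mxrank_tr eqn_leq rank_leq_col /=.
  by rewrite -{1}(trivial_invariants_rank x hinv) eP ev_mul mxrankM_maxl.
have nn : n = (r + \rank (rnull P))%N by rewrite rank_rnull hrk subnKC // ltnW.
have mm : m = (\rank (lnull P) + r)%N by rewrite rank_lnull hrk subnK // ltnW.
have nr0 : (0 < n - r)%N by rewrite subn_gt0.
have mr0 : (0 < m - r)%N by rewrite subn_gt0.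
have [N [hN _]] := minimal_indicesP hright.
rewrite balanced_sum // => sN.
have [M [hM _]] := minimal_indicesP hleft.
rewrite balanced_sum // => sM.
have RN : R' *m N^T = 0.
  have h : L *m (R' *m N^T) = 0.
    by rewrite mulmxA -eP; apply: rnull_basis_mul (proj1 hN).
  apply: trmx_inj; rewrite trmx0; apply: (pw_free_cancel pL).
  by rewrite -trmx_mul h trmx0.
have NR : N *m R'^T = 0 by apply: trmx_inj; rewrite trmx_mul trmxK RN trmx0.
have ML : M *m (L^T)^T = 0.
  rewrite trmxK; apply: (pw_free_cancel pR).
  by rewrite -mulmxA -eP; apply: lnull_basis_mul (proj1 hM).
have sR : sumdeg R' = a.
  apply/eqP; rewrite eqn_leq -sN; apply/andP; split.
    exact: (dual_sum_le nn bR lR pR (rowbd_rowdeg N) (minimal_pw_free hN) RN).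
  apply: (dual_sum_le _ (rowbd_rowdeg N) (minimal_reduced hN) (minimal_pw_free hN) bR pR NR).
  by rewrite addnC.
(* Only this direction is available for [L]. It suffices: predictability bounds each sum of paired
   degrees by [d], and [r] such numbers with total at least [r * d] all equal [d]. *)
have sL : (r * d - a <= sumdeg L^T)%N.
  rewrite -sM; exact: (dual_sum_le mm (rowbd_rowdeg M) (minimal_reduced hM) (minimal_pw_free hM) (rowbd_rowdeg _) pL ML).
have gt0L i := minimal_row_gt0 i (pw_free_fracmx pL).
have gt0R i := minimal_row_gt0 i (pw_free_fracmx pR).
have le i : (rowdeg L^T i + rowdeg R' i <= d)%N.
  rewrite -ltnS -addSn -gt0L.
  have hz u j : (size ((L *m R') u j) <= d.+1)%N by rewrite -eP; apply/mxsizeP.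
  have hd u : L u i != 0 -> (size (L u i) + rowdeg R' i <= d.+1)%N.
    by apply: (predictable_degree bR lR).
  suff : (mxsize (row i L^T) <= d.+1 - rowdeg R' i)%N.
    by rewrite gt0L; move: (rowdeg _ _) (rowdeg R' i) => x y; lia.
  apply/mxsize_rowP => u; rewrite mxE; have [->|Lu] := eqVneq (L u i) 0.
    by rewrite size_poly0.
  by rewrite leq_subRL ?[(_ + size _)%N]addnC ?hd // (leq_trans (leq_addl _ _) (hd u Lu)).
have tight : forall i, (rowdeg L^T i + rowdeg R' i = d)%N.
  apply: sum_tight => //; rewrite big_split /= -/(sumdeg L^T) -/(sumdeg R') sR.
  by rewrite addnC -leq_subLR.
exists L, R'; split=> //; exists (rowdeg R'); split=> // i.
split; first by rewrite -(tight i) leq_addl.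
  exact: gt0R.
by rewrite mxsize_col gt0L -(tight i) addnK.
Qed.

End Duality.

(** * Reversed polynomials, the behaviour at infinity, and the inclusion of MH_a in O_a *)

Section Reversal.
Set Implicit Arguments. Unset Strict Implicit. Unset Printing Implicit Defensive.
Import Order.TTheory GRing.Theory Num.Theory.
Local Open Scope ring_scope.
Variable R : realType.
Local Notation C := R[i].
Local Notation PC := {poly C}.
Local Notation FC := {fraction {poly C}}.

Lemma horner_revd d (p : PC) (x : C) : (size p <= d.+1)%N -> x != 0 ->
  (revd d p).[x] = x ^+ d * p.[x^-1].
Proof.
move=> hp x0; rewrite /revd horner_poly (horner_coef_wide _ hp) mulr_sumr.
rewrite (reindex_inj rev_ord_inj) /=; apply: eq_bigr => k _.
have kd : (k <= d)%N by rewrite -ltnS.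
rewrite subSS subKn // mulrCA; congr (_ * _).
by rewrite exprVn -expfB_cond // (negbTE x0).
Qed.

Lemma poly_eq_nonzero (p q : PC) : (forall x, x != 0 -> p.[x] = q.[x]) -> p = q.
Proof.
move=> h; apply/eqP; rewrite -subr_eq0; apply/negPn/negP => n0.
pose s : seq C := [seq k.+1%:R | k <- iota 0 (size (p - q))].
have us : uniq s by rewrite map_inj_uniq ?iota_uniq // => i j /eqP; rewrite eqr_nat => /eqP [].
have as' : all (root (p - q)) s.
  apply/allP => x /mapP [k _ ->]; rewrite rootE hornerD hornerN h ?subrr //.
  by rewrite pnatr_eq0.
by have := max_poly_roots n0 as' us; rewrite size_map size_iota ltnn.
Qed.

Definition revrows p k (e : 'I_p -> nat) (B : 'M[PC]_(p, k)) : 'M[PC]_(p, k) :=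
  \matrix_(i, j) revd (e i) (B i j).

(** At 0 the reversed matrix evaluates to the leading matrix; at any other [x] it is the value at
    [x^-1] with its rows scaled by nonzero powers of [x]. *)
Lemma pw_free_revrows p k (e : 'I_p -> nat) (B : 'M[PC]_(p, k)) :
  rowbd e B -> row_free (leadmx e B) -> pw_free B -> pw_free (revrows e B).
Proof.
move=> hb hl hB x; have [->|x0] := eqVneq x 0.
  suff -> : ev 0 (revrows e B) = leadmx e B by [].
  apply/matrixP => i j; rewrite !mxE /= /horner_eval horner_coef0 /revd coef_poly /=.
  by rewrite subn0.
have -> : ev x (revrows e B) = diag_mx (\row_i x ^+ e i) *m ev x^-1 B.
  apply/matrixP => i j; rewrite mul_diag_mx !mxE /= /horner_eval.
  exact: horner_revd.
rewrite /row_free mxrankMfree // -/(row_free _) row_free_unit unitmxE det_diag unitfE.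
by apply/prodf_neq0 => i _; rewrite mxE expf_neq0.
Qed.

Lemma map_revd_mul m n r d (e : 'I_r -> nat) (L : 'M[PC]_(m, r)) (B : 'M[PC]_(r, n)) :
  (forall i, (e i <= d)%N) -> rowbd (fun i => d - e i)%N L^T -> rowbd e B ->
  map_mx (revd d) (L *m B) = (revrows (fun i => d - e i)%N L^T)^T *m revrows e B.
Proof.
move=> hd hL hB; apply/matrixP => u j; rewrite !mxE; apply: poly_eq_nonzero => x x0.
have hs i : (size (L u i * B i j)%R <= d.+1)%N.
  rewrite -(subnK (hd i)); apply: size_mul_bound; last exact: hB.
  by have := hL i u; rewrite mxE.
rewrite horner_revd //; last first.
  by apply: (leq_trans (size_sum _ _ _)); apply/bigmax_leqP => i _; apply: hs.
rewrite !horner_sum mulr_sumr; apply: eq_bigr => i _.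
rewrite !mxE !hornerM !horner_revd //; last by have := hL i u; rewrite mxE.
by rewrite -{1}(subnK (hd i)) exprD mulrACA.
Qed.

Lemma trivial_invariants_mul m n r (L : 'M[PC]_(m, r)) (B : 'M[PC]_(r, n)) :
  pw_free L^T -> pw_free B -> invariant_polys (L *m B) (nseq r 1).
Proof.
move=> hL hB.
have rn : (r <= n)%N by have := rank_leq_col (ev 0 B); rewrite (eqP (hB 0)).
have rm : (r <= m)%N by have := rank_leq_col (ev 0 L^T); rewrite (eqP (hL 0)).
have [U uU eU] := pw_free_completion hL; have [V uV eV] := pw_free_completion hB.
split.
- by rewrite size_nseq leq_min rm rn.
- by apply/allP => p /nseqP [-> _]; rewrite monic1.
- by move=> i; rewrite size_nseq => ir; rewrite !nth_nseq ir (ltnW ir) dvdpp.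
exists U^T, V; split; rewrite /unimodular -?unitmxE ?unitmx_tr //.
have e1 : U^T *m L = pid_mx r by rewrite -[L]trmxK -trmx_mul eU tr_pid_mx.
by rewrite mulmxA e1 -mulmxA eV pid_mx_id // diag_seq1.
Qed.

Lemma eqmx_kermx_mulr (F : fieldType) q p k (A : 'M[F]_(q, p)) (B : 'M[F]_(p, k)) :
  row_free B -> (kermx (A *m B) :=: kermx A)%MS.
Proof.
move=> fB; apply/eqmxP; apply/andP; split; apply/sub_kermxP.
  by apply: (row_free_inj fB); rewrite -mulmxA mulmx_ker mul0mx.
by rewrite mulmxA mulmx_ker mul0mx.
Qed.

Lemma minimal_indices_eqmx q q' k (S : 'M[FC]_(q, k)) (S' : 'M[FC]_(q', k)) s :
  (S :=: S')%MS -> minimal_indices S s -> minimal_indices S' s.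
Proof.
move=> e [p [B [[hB hm] hs]]].
have h p' (B' : 'M[PC]_(p', k)) : poly_basis_of S B' = poly_basis_of S' B'.
  by rewrite /poly_basis_of !e.
by exists p, B; split=> //; split; [rewrite -h | move=> B'; rewrite -h; apply: hm].
Qed.

Lemma degRB_le r d a (i : 'I_r) : (a <= r * d)%N -> (degRB a i <= d)%N.
Proof.
case: r i => [[]//|r] i; rewrite mulnC => ad.
have ha : (a %/ r.+1 <= d)%N by rewrite -(mulnK d (ltn0Sn r)) leq_div2r.
rewrite /degRB /tR /dR; case: ifP => // hi; rewrite ltn_neqAle ha andbT.
(* If the quotient were already [d], the bound on [a] would force the remainder to be 0, leaving no
   index below [tR]. *)
apply/eqP => e; have := divn_eq a r.+1; rewrite e => e2.
by move: ad; rewrite e2 -{2}[(d * _)%N]addn0 leq_add2l leqn0 => /eqP h0; rewrite h0 in hi.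
Qed.

Lemma mxsize_mul m n r d (e : 'I_r -> nat) (L : 'M[PC]_(m, r)) (B : 'M[PC]_(r, n)) :
  (forall i, (e i <= d)%N) -> rowbd (fun i => d - e i)%N L^T -> rowbd e B ->
  (mxsize (L *m B) <= d.+1)%N.
Proof.
move=> hd hL hB; apply/mxsizeP => u j; rewrite mxE.
apply: (leq_trans (size_sum _ _ _)); apply/bigmax_leqP => i _.
rewrite -(subnK (hd i)); apply: size_mul_bound; last exact: hB.
by have := hL i u; rewrite mxE.
Qed.

Lemma MHset_sub_Oset m n r d a : (a <= r * d)%N ->
  psubset (MHset R m n r d a) (Oset R m n r d a).
Proof.
move=> ad P [L [B [-> [[cB mL mB] iL iB]]]].
have hd i : (degRB a i <= d)%N := degRB_le i ad.
have eB : rowdeg B = degRB a (r := r) by apply: funext => i; rewrite /rowdeg (proj1 (cB i)).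
have eL : rowdeg L^T = (fun i => d - degRB a i)%N.
  by apply: funext => i; rewrite /rowdeg -mxsize_col (proj2 (cB i)).
have bB := rowbd_rowdeg B; have bL := rowbd_rowdeg L^T.
have lB := minimal_reduced mB; have lL := minimal_reduced mL.
rewrite eB in bB lB; rewrite eL in bL lL.
have pB := minimal_pw_free mB; have pL := minimal_pw_free mL.
have fB := pw_free_fracmx pB; have fL := pw_free_fracmx pL.
split.
- split; first exact: mxsize_mul bB.
  rewrite /normal_rank fracmxM mxrankMfree // -mxrank_tr -fracmx_tr.
  exact/eqP.
- exact: trivial_invariants_mul.
- exists (nseq r 1); split; last first.
    (* The multiplicity of 0 as a root of the constant 1 is read off the empty product of linear
       factors. *)
    by rewrite map_nseq; have := mu_prod_XsubC (0 : C) [::]; rewrite big_nil => ->.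
  (* Reversal is multiplicative for matching degree bounds, so infinity is treated like the finite
     points, with the reversed factors in place of the factors. *)
  rewrite (map_revd_mul hd bL bB); apply: trivial_invariants_mul.
    by rewrite trmxK; apply: pw_free_revrows.
  exact: pw_free_revrows.
- apply: minimal_indices_eqmx iL; rewrite /lnull fracmxM.
  exact/eqmx_sym/eqmx_kermx_mulr.
apply: minimal_indices_eqmx iB; rewrite /rnull fracmxM trmx_mul.
by apply/eqmx_sym/eqmx_kermx_mulr; rewrite -fracmx_tr.
Qed.

End Reversal.

(** * Multiplication by a polynomial matrix as a linear system on coefficients *)

Section Sylvester.
Set Implicit Arguments. Unset Strict Implicit. Unset Printing Implicit Defensive.
Import Order.TTheory GRing.Theory Num.Theory.
Local Open Scope ring_scope.
Variable R : realType.
Local Notation C := R[i].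
Local Notation PC := {poly C}.

(* Index set of the coefficients of a vector whose k-th entry has size at most nu k. *)
Definition coef_index k (nu : 'I_k -> nat) : finType := {i : 'I_k & 'I_(nu i)}.

Definition blk k (nu : 'I_k -> nat) (u : 'I_#|coef_index nu|) : 'I_k := tag (enum_val u).
Definition expo k (nu : 'I_k -> nat) (u : 'I_#|coef_index nu|) : nat := tagged (enum_val u).

Definition coefs k (nu : 'I_k -> nat) (x : 'cV[PC]_k) : 'rV[C]_#|coef_index nu| :=
  \row_u (x (blk u) 0)`_(expo u).

Definition vecp k (nu : 'I_k -> nat) (w : 'rV[C]_#|coef_index nu|) : 'cV[PC]_k :=
  \col_i \sum_(p < nu i) w 0 (enum_rank (Tagged (fun i => 'I_(nu i)) p)) *: 'X^p.
Arguments vecp {k} nu w.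

(** The bounds count coefficients, so the value 0 is meaningful: it forces the entry to vanish. *)
Definition szbd k (nu : 'I_k -> nat) (x : 'cV[PC]_k) :=
  forall i, (size (x i ord0) <= nu i)%N.

Lemma size_vecp k (nu : 'I_k -> nat) w : szbd nu (vecp nu w).
Proof.
move=> i; rewrite mxE; apply: (leq_trans (size_sum _ _ _)); apply/bigmax_leqP => p _.
by apply: leq_trans (size_scale_leq _ _) _; rewrite size_polyXn.
Qed.

Lemma coef_vecp k (nu : 'I_k -> nat) w : coefs nu (vecp nu w) = w.
Proof.
apply/rowP => u; rewrite !mxE coef_sum /blk /expo (bigD1 (tagged (enum_val u))) //= big1 ?addr0.
  rewrite coefZ coefXn eqxx mulr1; congr (w 0 _).
  by rewrite -[RHS]enum_valK; congr enum_rank; case: (enum_val u).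
move=> p hp; rewrite coefZ coefXn; case: eqP => [e|_]; last by rewrite mulr0.
by case/eqP: hp; apply: val_inj.
Qed.

Lemma coefs_inj k (nu : 'I_k -> nat) x y : szbd nu x -> szbd nu y ->
  coefs nu x = coefs nu y -> x = y.
Proof.
move=> hx hy e; apply/colP => i; apply/polyP => p.
have [lt|le] := ltnP p (nu i); last first.
  by rewrite !nth_default // (leq_trans _ le) ?hx ?hy.
have /rowP /(_ (enum_rank (Tagged (fun i => 'I_(nu i)) (Ordinal lt)))) := e.
by rewrite !mxE /blk /expo enum_rankK.
Qed.

Lemma coefs0 k (nu : 'I_k -> nat) : coefs nu 0 = 0.
Proof. by apply/rowP => u; rewrite !mxE coef0. Qed.

Lemma szbd0 k (nu : 'I_k -> nat) : szbd nu 0.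
Proof. by move=> i; rewrite mxE size_poly0. Qed.

Lemma card_coef_index k (nu : 'I_k -> nat) : #|coef_index nu| = (\sum_i nu i)%N.
Proof.
rewrite card_tagged sumnE big_map big_enum /=.
by apply: eq_bigr => i _; rewrite card_ord.
Qed.

(* A generalized Sylvester matrix; it multiplies coefficient vectors from the right. *)
Definition sysmx r n (nu : 'I_n -> nat) (mu : 'I_r -> nat) (A : 'M[PC]_(r, n)) :
    'M[C]_(#|coef_index nu|, #|coef_index mu|) :=
  \matrix_(u, v) (A (blk v) (blk u) * 'X^(expo u))`_(expo v).

Lemma coefs_mul r n (nu : 'I_n -> nat) (mu : 'I_r -> nat) (A : 'M[PC]_(r, n)) x :
  szbd nu x -> coefs mu (A *m x) = coefs nu x *m sysmx nu mu A.
Proof.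
move=> hx; apply/rowP => v; rewrite !mxE.
pose F (q : coef_index nu) := (x (tag q) 0)`_(tagged q) *
   (A (blk v) (tag q) * 'X^(tagged q))`_(expo v).
transitivity (\sum_(q : coef_index nu) F q); last first.
  rewrite (reindex (@enum_val _ (coef_index nu))) /=; last first.
    by exists enum_rank => ? _; rewrite ?enum_valK ?enum_rankK.
  by apply: eq_bigr => u _; rewrite !mxE.
rewrite -(sig_big_dep (fun=> true) (fun _ _ => true) (fun i p => F (Tagged (fun i => 'I_(nu i)) p))) /=.
rewrite coef_sum; apply: eq_bigr => i _; rewrite /F /=.
rewrite {1}(_ : x i 0 = \sum_(p < nu i) (x i 0)`_p *: 'X^p); last first.
  rewrite -poly_def; apply/polyP => p; rewrite coef_poly; case: ltnP => // le.
  by rewrite nth_default // (leq_trans (hx i)).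
by rewrite mulr_sumr coef_sum; apply: eq_bigr => p _; rewrite -scalerAr coefZ.
Qed.

Lemma sysmx_line r n (nu : 'I_n -> nat) (mu : 'I_r -> nat) (A B : 'M[PC]_(r, n)) t :
  sysmx nu mu (A + t%:P *: B) = sysmx nu mu A + t *: sysmx nu mu B.
Proof.
by apply/matrixP => u v; rewrite !mxE mulrDl coefD -mulrA mul_polyC coefZ.
Qed.

(** With [D] a right inverse of [B], the product [(A + t *: B) *m D] is [A *m D + t%:M], singular
    only when [t] is an eigenvalue of [- (A *m D)]. *)
Lemma row_free_generic p q (A B : 'M[C]_(p, q)) : row_free B ->
  exists bad : seq C, forall t, t \notin bad -> row_free (A + t *: B).
Proof.
move=> /row_freeP [D eD]; pose M := - (A *m D).
have [bad ebad] := closed_field_poly_normal (char_poly M).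
exists bad => t ht.
have nroot : ~~ root (char_poly M) t.
  by rewrite ebad (monicP (char_poly_monic M)) scale1r root_prod_XsubC.
suff : (A + t *: B) *m D \in unitmx.
  move=> /mulmxV e; apply/row_freeP; exists (D *m invmx ((A + t *: B) *m D)).
  by rewrite mulmxA e.
rewrite mulmxDl -scalemxAl eD scalemx1 -row_free_unit -kermx_eq0.
move: nroot; rewrite -eigenvalue_root_char negbK /eigenspace.
have -> : M - t%:M = (- 1) *: (A *m D + t%:M) by rewrite scaleN1r opprD.
have n1 : (- 1 : C) != 0 by rewrite oppr_eq0 oner_eq0.
by rewrite !kermx_eq0 /row_free (eqmx_scale _ n1).
Qed.

Section System.
Variables (r n N : nat) (e : 'I_r -> nat) (nu : 'I_n -> nat).
Hypothesis nuN : forall k, (nu k <= N.+1)%N.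
Local Notation mu := (fun i => e i + N.+1)%N.

Lemma szbd_mul (A : 'M[PC]_(r, n)) x : rowbd e A -> szbd nu x -> szbd mu (A *m x).
Proof.
move=> hA hx i; rewrite mxE; apply: (leq_trans (size_sum _ _ _)); apply/bigmax_leqP => k _.
apply: leq_trans (size_polyMleq _ _) _.
by move: (hA i k) (hx k) (nuN k); move: (size _) (size _) => a b; lia.
Qed.

Lemma sysmx_free (A : 'M[PC]_(r, n)) : rowbd e A ->
  (forall x, szbd nu x -> A *m x = 0 -> x = 0) -> row_free (sysmx nu mu A).
Proof.
move=> hA h; apply/row_freeP0 => w hw; rewrite -[w](coef_vecp (nu := nu)).
rewrite (h (vecp nu w)) ?coefs0 //; first exact: size_vecp.
apply: (coefs_inj (szbd_mul hA (size_vecp w)) (@szbd0 _ _)).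
by rewrite coefs0 (coefs_mul _ _ (size_vecp w)) coef_vecp.
Qed.

Lemma sysmx_inj (A : 'M[PC]_(r, n)) x : row_free (sysmx nu mu A) ->
  szbd nu x -> A *m x = 0 -> x = 0.
Proof.
move=> fA hx h0; apply: (coefs_inj hx (@szbd0 _ _)); rewrite coefs0.
by apply: (row_free_inj fA); rewrite mul0mx -coefs_mul // h0 coefs0.
Qed.

(** Equality of the two coefficient counts makes the injective system bijective. *)
Lemma sysmx_surj (A : 'M[PC]_(r, n)) y : rowbd e A -> row_free (sysmx nu mu A) ->
  (\sum_k nu k = \sum_i (e i + N.+1))%N -> szbd mu y ->
  exists2 x, szbd nu x & A *m x = y.
Proof.
move=> hA fA es hy.
have full : row_full (sysmx nu mu A).
  by rewrite /row_full (eqP fA) !card_coef_index es.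
have /submxP [w ew] := submx_full (coefs mu y) full.
exists (vecp nu w); first exact: size_vecp.
apply: (coefs_inj (szbd_mul hA (size_vecp w)) hy).
by rewrite (coefs_mul _ _ (size_vecp w)) coef_vecp.
Qed.

(* Surjectivity of x |-> A x on the constant vectors gives a polynomial right inverse,
   and on the vectors of top degree a right inverse of the leading matrix. *)
Lemma sysmx_pw_free (A : 'M[PC]_(r, n)) : rowbd e A -> row_free (sysmx nu mu A) ->
  (\sum_k nu k = \sum_i (e i + N.+1))%N -> pw_free A.
Proof.
move=> hA fA es x.
have H i : exists y, szbd nu y /\ A *m y = delta_mx i 0.
  have [|y hy ey] := sysmx_surj (y := delta_mx i 0) hA fA es; last by exists y.
  move=> j; rewrite mxE; apply: leq_trans (_ : 1 <= _)%N; last by rewrite addnS.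
  by case: (_ && _) => /=; [rewrite size_poly1 | rewrite size_poly0].
have [f hf] := choice H.
apply/row_freeP; exists (ev x (\matrix_(k, i) f i k 0)); rewrite -ev_mul.
suff -> : A *m (\matrix_(k, i) f i k 0) = 1%:M by rewrite /ev map_mx1.
apply/matrixP => i j; have [_ /matrixP /(_ i 0)] := hf j.
rewrite !mxE andbT => <-; apply: eq_bigr => k _; by rewrite mxE.
Qed.

Lemma sysmx_lead_free (A : 'M[PC]_(r, n)) : rowbd e A -> row_free (sysmx nu mu A) ->
  (\sum_k nu k = \sum_i (e i + N.+1))%N -> row_free (leadmx e A).
Proof.
move=> hA fA es.
(* The target is the monomial of highest degree that the bounds admit; only the coefficients of
   degree [N] in its preimage contribute to it, and they form a column of the right inverse. *)
have H i : exists y, szbd nu y /\ A *m y = \col_j (if j == i then 'X^(e i + N) else 0).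
  have [|y hy ey] := sysmx_surj (y := \col_j (if j == i then 'X^(e i + N) else 0)) hA fA es.
    by move=> j; rewrite mxE; case: eqP => [->|_]; rewrite ?size_poly0 // size_polyXn addnS.
  by exists y.
have [f hf] := choice H.
apply/row_freeP; exists (\matrix_(k, i) (f i k 0)`_N).
apply/matrixP => i j; have [hs /matrixP /(_ i 0) h] := hf j.
have := congr1 (fun p : PC => p`_(e i + N)) h; rewrite /= !mxE coef_sum.
have -> : (if i == j then 'X^(e j + N) else 0 : PC)`_(e i + N) = (i == j)%:R.
  by case: eqP => [->|_]; rewrite ?coef0 // coefXn eqxx.
move=> <-; apply: eq_bigr => k _; rewrite !mxE coef_mul_top //.
exact: leq_trans (hs k) (nuN k).
Qed.

End System.

End Sylvester.

(** * Nonsingular systems have balanced right minimal indices *)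

Section Generic.
Set Implicit Arguments. Unset Strict Implicit. Unset Printing Implicit Defensive.
Import Order.TTheory GRing.Theory Num.Theory.
Local Open Scope ring_scope.
Variable R : realType.
Local Notation C := R[i].
Local Notation PC := {poly C}.

(** The excesses [f i - al] add up to [s], while at least [s] of them are positive; hence every
    positive excess is exactly 1. *)
Lemma balanced_perm c al s (f : 'I_c -> nat) : (s <= c)%N ->
  (forall i, (al <= f i)%N) -> (#|[set i | f i == al]| <= c - s)%N ->
  (\sum_i f i = c * al + s)%N ->
  perm_eq [seq f i | i <- enum 'I_c] (nseq s al.+1 ++ nseq (c - s) al).
Proof.
move=> sc hal hcard hsum.
have sge : (s <= \sum_(i < c) (f i != al))%N.
  have -> : (\sum_(i < c) (f i != al) = c - #|[set i | f i == al]|)%N.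
    have -> : #|[set i | f i == al]| = (\sum_(i < c) (f i == al))%N.
      by rewrite -sum1dep_card big_mkcond /=; apply: eq_bigr => i _; case: eqP.
    have : (\sum_(i < c) (f i == al) + \sum_(i < c) (f i != al) = c)%N.
      rewrite -big_split /= -[RHS](card_ord c) -sum1_card.
      by apply: eq_bigr => i _; case: eqP.
    by lia.
  by move: hcard sc; move: #|_| => x; lia.
have hpos i : ((f i != al) <= f i - al)%N.
  by have := hal i; case: eqP => //=; lia.
have sub : (\sum_i (f i - al) = s)%N.
  have : (\sum_(i < c) (f i - al) + \sum_(i < c) al = \sum_i f i)%N.
    by rewrite -big_split /=; apply: eq_bigr => i _; rewrite subnK.
  by rewrite hsum sum_nat_const card_ord addnC => /addnI.
have heq i : (f i - al = (f i != al))%N.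
  apply/eqP; rewrite eqn_leq hpos andbT leqNgt; apply/negP => lt.
  have : (\sum_(i < c) (f i != al) < \sum_i (f i - al))%N.
    rewrite (bigD1 i) //= [X in (_ < X)%N](bigD1 i) //= -addSn; apply: leq_add => //.
    exact: leq_sum.
  by rewrite sub ltnNge sge.
set t := [seq f i | i <- enum 'I_c].
have st : size t = c by rewrite size_map size_enum_ord.
have c1 : count (pred1 al.+1) t = s.
  rewrite -sum1_count big_mkcond big_map big_enum /= -sub; apply: eq_bigr => i _.
  by rewrite heq; have := heq i; have := hal i; case: eqP => [->|]; case: eqP => //=; lia.
have t2 x : x \in t -> x != al.+1 -> x = al.
  by case/mapP => i _ ->; have := heq i; have := hal i; case: eqP => //=; lia.
rewrite -(perm_filterC (pred1 al.+1) t).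
have -> : filter (pred1 al.+1) t = nseq s al.+1.
  have /all_pred1P := filter_all (pred1 al.+1) t.
  by rewrite size_filter c1.
have -> : filter (predC (pred1 al.+1)) t = nseq (c - s) al.
  have : all (pred1 al) (filter (predC (pred1 al.+1)) t).
    by apply/allP => x; rewrite mem_filter => /andP [h xt]; apply/eqP/t2.
  move/all_pred1P => ->; congr nseq; rewrite size_filter.
  by have := count_predC (pred1 al.+1) t; rewrite c1 st; lia.
exact: perm_refl.
Qed.

(* With these bounds on x and the bounds e i + alpha + 1 on A x, the linear system
   x |-> A x is square; its nonsingularity forces balanced right minimal indices. *)
Definition nu_ (n r a k : nat) : nat :=
  if (k < a %% (n - r))%N || (n - r <= k)%N then (a %/ (n - r)).+1%N else (a %/ (n - r))%N.

Lemma nu_le n r a k : (nu_ n r a k <= (a %/ (n - r)).+1)%N.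
Proof. by rewrite /nu_; case: ifP. Qed.

Lemma nu_ge n r a k : (a %/ (n - r) <= nu_ n r a k)%N.
Proof. by rewrite /nu_; case: ifP. Qed.

Lemma sum_nu_head n r a k : (k <= n - r)%N ->
  (\sum_(0 <= l < k) nu_ n r a l = k * (a %/ (n - r)) + minn k (a %% (n - r)))%N.
Proof.
elim: k => [|k IH] hk; first by rewrite big_nil min0n.
rewrite big_nat_recr //= IH ?(ltnW hk) // /nu_ [(n - r <= k)%N]leqNgt hk orbF.
by case: ltnP => h; rewrite /minn; case: ltnP; case: ltnP; lia.
Qed.

Lemma sum_nu n r a : (r < n)%N ->
  (\sum_(k < n) nu_ n r a k = a + r * (a %/ (n - r)).+1)%N.
Proof.
move=> rn; rewrite -(big_mkord xpredT (nu_ n r a)) (big_cat_nat (n := n - r)) ?leq_subr //=.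
rewrite sum_nu_head // (minn_idPr _); last by rewrite ltnW // ltn_mod subn_gt0.
rewrite mulnC -divn_eq; congr (_ + _)%N.
rewrite (eq_big_nat _ _ (F2 := fun=> (a %/ (n - r)).+1)) => [|i /andP [h _]].
  by rewrite sum_nat_const_nat subKn // ltnW.
by rewrite /nu_ h orbT.
Qed.

(** A constant combination of rows of a minimal basis of the right nullspace must vanish once it
    fits the bounds [nu_]. Single rows then have degree at least alpha, combinations of rows of
    degree alpha limit how many there are, and duality fixes the degree sum. *)
Lemma sysmx_right_indices n r a (e : 'I_r -> nat) (A : 'M[PC]_(r, n)) :
  (r < n)%N -> (\sum_i e i = a)%N -> rowbd e A ->
  row_free (sysmx (fun k : 'I_n => nu_ n r a k) (fun i => e i + (a %/ (n - r)).+1)%N A) ->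
  [/\ pw_free A, row_free (leadmx e A) & minimal_indices (rnull A) (right_indices n r a)].
Proof.
move=> rn ea hA fA.
pose nu := fun k : 'I_n => nu_ n r a k.
have nuN k : (nu k <= (a %/ (n - r)).+1)%N by apply: nu_le.
have es : (\sum_k nu k = \sum_i (e i + (a %/ (n - r)).+1))%N.
  by rewrite sum_nu // big_split /= ea sum_nat_const card_ord.
have pA := sysmx_pw_free nuN hA fA es; have lA := sysmx_lead_free nuN hA fA es.
split=> //.
have rk : normal_rank A = r by apply/eqP; exact: pw_free_fracmx pA.
have [N hN] : exists N : 'M[PC]_(n - r, n), minimal_basis_of (rnull A) N.
  by have := minimal_basis_exists (rnull A); rewrite rank_rnull rk.
exists (n - r)%N, N; split=> //.
have pN := minimal_pw_free hN; have lN := minimal_reduced hN; have bN := rowbd_rowdeg N.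
have AN := rnull_basis_mul (proj1 hN).
have NA : N *m A^T = 0 by apply: trmx_inj; rewrite trmx_mul trmxK AN trmx0.
set c := (n - r)%N in N hN pN lN bN AN NA *.
have c0 : (0 < c)%N by rewrite subn_gt0.
have nn : n = (r + c)%N by rewrite subnKC // ltnW.
have sN : sumdeg N = a.
  apply/eqP; rewrite eqn_leq -ea; apply/andP; split.
    apply: (dual_sum_le _ bN lN pN hA pA NA); by rewrite addnC.
  exact: (dual_sum_le nn hA lA pA bN pN AN).
have inj (u : 'rV[C]_c) : szbd nu ((map_mx polyC u *m N)^T) -> u = 0.
  move=> hs; have h0 : A *m (map_mx polyC u *m N)^T = 0.
    by rewrite trmx_mul mulmxA AN mul0mx.
  have := sysmx_inj fA hs h0 => /(congr1 trmx); rewrite trmxK trmx0 => /(pw_free_cancel pN) h.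
  apply/rowP => j; have /rowP /(_ j) := h; rewrite !mxE => /eqP.
  by rewrite polyC_eq0 => /eqP.
rewrite /right_indices /s_ /alpha -/c.
have sc : (a %% c < c)%N by rewrite ltn_mod.
apply: balanced_perm.
- exact: ltnW.
- move=> j; rewrite leqNgt; apply/negP => lt.
  suff /rowP /(_ j) /eqP : (delta_mx 0 j : 'rV[C]_c) = 0.
    by rewrite !mxE !eqxx oner_eq0.
  apply: inj => k; rewrite map_delta_mx -rowE !mxE.
  apply: leq_trans (bN j k) _; apply: leq_trans lt _; exact: nu_ge.
- set J := [set _ | _].
  have hk (l : 'I_(c - a %% c)) : (a %% c + l < n)%N.
    by rewrite nn; have := ltn_ord l; lia.
  pose kk l := Ordinal (hk l).
  (* The columns of [M] are the coordinates [a %% c <= k < c], the only ones where the bound is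
     alpha rather than alpha + 1. A vector in the left kernel of [M] combines the rows in [J] into
     one that fits the bounds, so the column count bounds the size of [J]. *)
  pose M : 'M[C]_(#|J|, c - a %% c) := \matrix_(u, l) (N (enum_val u) (kk l))`_(a %/ c).
  suff /eqP <- : row_free M by apply: rank_leq_col.
  apply/row_freeP0 => w hw.
  pose v : 'rV[C]_c := \row_j \sum_u w 0 u * (j == enum_val u)%:R.
  have ez k : (map_mx polyC v *m N) 0 k = \sum_u w 0 u *: N (enum_val u) k.
    rewrite mxE (eq_bigr (fun j => \sum_u (w 0 u * (j == enum_val u)%:R) *: N j k)) => [|j _].
      rewrite exchange_big /=; apply: eq_bigr => u _.
      rewrite (bigD1 (enum_val u)) //= eqxx mulr1 big1 ?addr0 // => j ju.
      by rewrite (negbTE ju) mulr0 scale0r.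
    by rewrite !mxE mul_polyC scaler_suml.
  have hJ (u : 'I_#|J|) : rowdeg N (enum_val u) = (a %/ c)%N.
    by have := enum_valP u; rewrite inE => /eqP.
  have v0 : v = 0.
    apply: inj => k; rewrite mxE ez.
    have h1 : (size (\sum_u w 0 u *: N (enum_val u) k)%R <= (a %/ c).+1)%N.
      apply: (leq_trans (size_sum _ _ _)); apply/bigmax_leqP => u _.
      by apply: leq_trans (size_scale_leq _ _) _; rewrite -(hJ u); apply: bN.
    rewrite /nu /nu_ -/c; case: ifP => //; move/negbT; rewrite negb_or -leqNgt -ltnNge => /andP [h2 h3].
    apply: size_top_coef0 => //.
    have lt : (k - a %% c < c - a %% c)%N by rewrite ltn_sub2r.
    have /rowP /(_ (Ordinal lt)) := hw; rewrite mxE [RHS]mxE => e0; rewrite -[RHS]e0 coef_sum; apply: eq_bigr => u _; rewrite coefZ !mxE; congr (_ * (N _ _)`_ _).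
    by apply: val_inj; rewrite /= subnKC.
  apply/rowP => u; have /rowP /(_ (enum_val u)) := v0; rewrite !mxE => <-.
  rewrite (bigD1 u) //= eqxx mulr1 big1 ?addr0 // => u' hu.
  by rewrite (inj_eq enum_val_inj) eq_sym (negbTE hu) mulr0.
- by rewrite -/(sumdeg N) sN mulnC -divn_eq.
Qed.

End Generic.

(** * An explicit sparse matrix with nonsingular system *)

Section Witness.
Set Implicit Arguments. Unset Strict Implicit. Unset Printing Implicit Defensive.
Import Order.TTheory GRing.Theory Num.Theory.
Local Open Scope ring_scope.
Variable R : realType.
Local Notation C := R[i].
Local Notation PC := {poly C}.

(** Provides the row in which a monomial of degree [M - E i] is admissible, that is, has degree
    between 0 and [e i]. *)
Lemma staircase r (e : 'I_r -> nat) (E : nat -> nat) M : (0 < r)%N -> E 0%N = 0%N ->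
  (forall i : 'I_r, E i.+1 = E i + e i)%N -> (M <= E r)%N ->
  exists i : 'I_r, (E i <= M <= E i + e i)%N.
Proof.
move=> r0 E0 ES hM; have ex : exists m, (M <= E m)%N by exists r.
case: (ex_minnP ex) => -[|m] hm hmin.
  by exists (Ordinal r0); rewrite /= E0; move: hm; rewrite E0 leqn0 => /eqP ->.
have mr : (m < r)%N by apply: hmin.
exists (Ordinal mr); rewrite -ES /= hm andbT leqNgt; apply/negP => lt.
by have := hmin m (ltnW lt); rewrite ltnn.
Qed.

Lemma shift_eq0 (p q : PC) m : (size p <= m)%N -> p + 'X^m * q = 0 -> p = 0 /\ q = 0.
Proof.
move=> hp h; have q0 : q = 0.
  apply/eqP; apply: contraTT hp => qn; rewrite -ltnNge.
  have -> : p = - ('X^m * q) by apply/eqP; rewrite -subr_eq0 opprK h.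
  rewrite size_polyN size_monicM ?monicXn // size_polyXn addSn /=.
  by rewrite -[X in (X < _)%N]addn0 ltn_add2l size_poly_gt0.
by move: h; rewrite q0 mulr0 addr0.
Qed.

(* Uniqueness of positional notation: the blocks X^(N k) f_k do not overlap. *)
Lemma positional_eq0 (nu N : nat -> nat) (f : nat -> PC) c g : N 0%N = 0%N ->
  (forall k, N k.+1 = N k + nu k)%N -> (forall k, (k < c)%N -> (size (f k) <= nu k)%N) ->
  \sum_(0 <= k < c) 'X^(N k) * f k + 'X^(N c) * g = 0 ->
  (forall k, (k < c)%N -> f k = 0) /\ g = 0.
Proof.
move=> N0 NS; elim: c g => [|c IH] g hf.
  by rewrite big_nil N0 expr0 mul1r add0r.
rewrite big_nat_recr //= NS exprD -addrA -mulrA -mulrDr => /IH [k kc|hk /shift_eq0 [|f0 g0]].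
- by apply: hf; apply: ltnW.
- exact: hf.
by split=> // k; rewrite ltnS leq_eqVlt => /predU1P [->|/hk].
Qed.

Lemma sum_nat_ord (f : nat -> PC) n (g : 'I_n -> PC) : (forall i : 'I_n, g i = f i) ->
  \sum_i g i = \sum_(0 <= i < n) f i.
Proof. by move=> h; rewrite big_mkord; apply: eq_bigr. Qed.

(* A = [A1 A2] with A2 bidiagonal (X^(e i) on the diagonal, -1 below) and one monomial in
   each column of A1, placed so that (X^(E i))_i A = (X^(N 0), ..., X^(N (c-1)), 0, ..., 0, X^a),
   where E and N are the partial sums of e and nu. *)
Lemma sysmx_witness n r a (e : 'I_r -> nat) : (0 < r)%N -> (r < n)%N ->
  (\sum_i e i = a)%N ->
  exists2 A : 'M[PC]_(r, n), rowbd e A &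
    forall x, szbd (fun k : 'I_n => nu_ n r a k) x -> A *m x = 0 -> x = 0.
Proof.
move=> r0 rn ea; pose c := (n - r)%N.
have nn : n = (c + r)%N by rewrite /c subnK // ltnW.
have c0 : (0 < c)%N by rewrite subn_gt0.
pose e' j : nat := oapp e 0%N (insub j).
have ee' (i : 'I_r) : e' i = e i by rewrite /e' valK.
pose E i := (\sum_(0 <= j < i) e' j)%N.
have E0 : E 0%N = 0%N by rewrite /E big_nil.
have ES (i : 'I_r) : (E i.+1 = E i + e i)%N by rewrite /E big_nat_recr //= ee'.
have Er : E r = a by rewrite /E big_mkord -ea; apply: eq_bigr => i _.
pose nu := nu_ n r a.
pose N k := (\sum_(0 <= l < k) nu l)%N.
have N0 : N 0%N = 0%N by rewrite /N big_nil.
have NS k : (N k.+1 = N k + nu k)%N by rewrite /N big_nat_recr.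
have Nc : N c = a.
  rewrite /N sum_nu_head // (minn_idPr _); last by rewrite ltnW // ltn_mod subn_gt0.
  by rewrite mulnC -divn_eq.
have Nle k : (k <= c)%N -> (N k <= E r)%N.
  by move=> kc; rewrite Er -Nc /N [X in (_ <= X)%N](big_cat_nat (n := k)) //= leq_addr.
have H (k : nat) : exists i : 'I_r, (k <= c)%N -> (E i <= N k <= E i + e i)%N.
  have [kc|ck] := leqP k c; last by exists (Ordinal r0).
  by have [i hi] := staircase r0 E0 ES (Nle k kc); exists i.
have [idx hidx] := choice H.
pose A : 'M[PC]_(r, n) := \matrix_(i, k)
  if (k < c)%N then (if i == idx k then 'X^(N k - E i) else 0)
  else if k == (c + i)%N :> nat then 'X^(e i)
  else if k.+1 == (c + i)%N :> nat then -1 else 0.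
exists A.
  move=> i k; rewrite mxE; case: ifP => kc.
    case: eqP => [->|_]; last by rewrite size_poly0.
    by rewrite size_polyXn ltnS leq_subLR; have /andP [] := hidx k (ltnW kc).
  case: ifP => _; first by rewrite size_polyXn.
  by case: ifP => _; rewrite ?size_poly0 // size_polyN size_poly1.
move=> x hx Ax0.
(* On the bidiagonal block [w] telescopes, ['X^(E j) * 'X^(e j)] cancelling ['X^(E j.+1)], so only
   the last column survives. *)
pose w : 'rV[PC]_r := \row_i 'X^(E i).
pose W k : PC := if (k < c)%N then 'X^(N k) else if k.+1 == n then 'X^a else 0.
have wA (k : 'I_n) : (w *m A) 0 k = W k.
  rewrite mxE /W; case: ltnP => kc.
    rewrite (bigD1 (idx k)) //= big1 ?addr0 => [|i ik].
      rewrite !mxE kc eqxx -exprD subnKC //; by have /andP [] := hidx k (ltnW kc).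
    by rewrite !mxE kc (negbTE ik) mulr0.
  have jr : (k - c < r)%N by have := ltn_ord k; lia.
  have [j ejk] : exists j : 'I_r, k = (c + j)%N :> nat.
    by exists (Ordinal jr); rewrite /= subnKC.
  rewrite (bigD1 j) //= !mxE ltnNge kc /= -ejk eqxx -exprD -ES.
  have -> : (k.+1 == n) = (j.+1 == r) by rewrite ejk; apply/eqP/eqP; lia.
  case: eqP => [ejr|jr'].
    rewrite ejr Er big1 ?addr0 // => i ij; rewrite !mxE ltnNge kc /=.
    case: eqP => [h|_]; first by case/eqP: ij; apply: val_inj => /=; lia.
    by case: eqP => [h|_]; [have := ltn_ord i; rewrite /= in ejr; lia | rewrite mulr0].
  have j1r : (j.+1 < r)%N by rewrite ltn_neqAle ltn_ord andbT; apply/eqP.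
  rewrite (bigD1 (Ordinal j1r)) /=; last by apply/eqP => /(congr1 val) /=; lia.
  rewrite !mxE ltnNge kc /= ; case: eqP => [|_]; first by lia.
  case: eqP => [_|]; last by lia.
  rewrite mulrN1 big1 ?addr0 ?subrr // => i /andP [ij ij'].
  rewrite !mxE ltnNge kc /=; case: eqP => [h|_]; first by case/eqP: ij; apply: val_inj => /=; lia.
  case: eqP => [h|_]; last by rewrite mulr0.
  by case/eqP: ij'; apply: val_inj => /=; lia.
pose x' k : PC := oapp (fun i : 'I_n => x i 0) 0 (insub k).
have ex' (k : 'I_n) : x' k = x k 0 by rewrite /x' valK.
have cn1 : (c <= n.-1)%N by lia.
have eq0 : \sum_(0 <= k < c) 'X^(N k) * x' k + 'X^(N c) * x' n.-1 = 0.
  have : (w *m A *m x) 0 0 = 0 by rewrite -mulmxA Ax0 mulmx0 mxE.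
  rewrite mxE (@sum_nat_ord (fun k => W k * x' k)) => [|k]; last by rewrite wA ex'.
  rewrite (big_cat_nat (n := c)) //=; last by rewrite nn leq_addr.
  rewrite (eq_big_nat _ _ (F2 := fun k => 'X^(N k) * x' k)) => [|k /andP [_ kc]]; last by rewrite /W kc.
  rewrite -(prednK (n := n)); last by lia.
  rewrite [X in _ + X](big_nat_recr) //= [X in _ + (X + _)]big1_seq ?add0r => [|k].
    by rewrite /W ltnNge cn1 prednK ?eqxx ?Nc //; lia.
  rewrite mem_index_iota => /andP [_ /andP [ck kn]]; rewrite /W ltnNge ck /=.
  by case: eqP => [|_]; [lia | rewrite mul0r].
have hs k : (k < c)%N -> (size (x' k) <= nu k)%N.
  move=> kc; have kn : (k < n)%N by rewrite nn (leq_trans kc) ?leq_addr.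
  by have := hx (Ordinal kn); rewrite -ex'.
have [hk _] := positional_eq0 N0 NS hs eq0.
(* Forward substitution: once the first [c] entries vanish, row [j] relates [x' (c + j)] to its
   predecessor alone. *)
have hc j : (j < r)%N -> x' (c + j)%N = 0.
  elim/ltn_ind: j => j IH jr.
  have cj : (c + j < n)%N by rewrite nn ltn_add2l.
  have /matrixP /(_ (Ordinal jr) 0) := Ax0; rewrite !mxE (bigD1 (Ordinal cj)) //= big1 ?addr0.
    rewrite !mxE /= ltnNge leq_addr /= eqxx -ex' /= => /eqP.
    by rewrite mulf_eq0 -size_poly_eq0 size_polyXn /= => /eqP.
  move=> k hkj; rewrite !mxE /= -ex'; case: ltnP => kc; first by rewrite hk ?mulr0.
  case: eqP => [h|_]; first by case/eqP: hkj; apply: val_inj.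
  case: eqP => [h|_]; last by rewrite mul0r.
  have -> : (k = c + (k - c) :> nat)%N by rewrite subnKC.
  by rewrite IH ?mulr0 //; lia.
apply/colP => k; rewrite mxE -ex'; have [kc|ck] := ltnP k c; first exact: hk.
by rewrite -(subnKC ck) hc //; have := ltn_ord k; lia.
Qed.

End Witness.

(** * Closures and limits along quadratic curves *)

Section Closure.
Set Implicit Arguments. Unset Strict Implicit. Unset Printing Implicit Defensive.
Import Order.TTheory GRing.Theory Num.Theory.
Local Open Scope ring_scope.
Variable R : realType.
Local Notation C := R[i].
Local Notation PC := {poly C}.

(** The factor 2 buys a triangle inequality for the squared distance without square roots. *)
Lemma norm_sqr_add (x y : C) : `|x + y| ^+ 2 <= 2 * `|x| ^+ 2 + 2 * `|y| ^+ 2.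
Proof.
apply: (@le_trans _ _ ((`|x| + `|y|) ^+ 2)).
  by rewrite ler_sqr ?nnegrE ?addr_ge0 ?normr_ge0 // ler_normD.
rewrite -subr_ge0.
have -> : 2 * `|x| ^+ 2 + 2 * `|y| ^+ 2 - (`|x| + `|y|) ^+ 2 = (`|x| - `|y|) ^+ 2 by ring.
by rewrite -realEsqr realB ?normr_real.
Qed.

Lemma dist2_triangle m n d (P Q S : 'M[PC]_(m, n)) :
  dist2 d P S <= 2 * dist2 d P Q + 2 * dist2 d Q S.
Proof.
rewrite /dist2 !mulr_sumr -big_split; apply: ler_sum => k _.
rewrite !mulr_sumr -big_split; apply: ler_sum => i _.
rewrite !mulr_sumr -big_split; apply: ler_sum => j _ /=.
have -> : (P i j)`_k - (S i j)`_k = ((P i j)`_k - (Q i j)`_k) + ((Q i j)`_k - (S i j)`_k) by ring.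
exact: norm_sqr_add.
Qed.

Lemma closure_trans m n d (S1 S2 : 'M[PC]_(m, n) -> Prop) :
  (forall P, S1 P -> closure_d d S2 P) -> psubset (closure_d d S1) (closure_d d S2).
Proof.
move=> h P [hP hS]; split=> // eps eps0.
(* Halving compensates for the factors 2: each of the two terms becomes half of [eps * eps]. *)
have e2 : 0 < eps / 2 by rewrite divr_gt0.
have [Q [/h [_ hQ] sQ dPQ]] := hS _ e2.
have [Q' [sQ' bQ' dQ]] := hQ _ e2.
exists Q'; split=> //; apply: le_lt_trans (dist2_triangle d P Q Q') _.
have -> : eps * eps = 2 * (eps / 2 * (eps / 2)) + 2 * (eps / 2 * (eps / 2)) by field.
by rewrite ltrD // ltr_pM2l.
Qed.

Lemma dist2xx m n d (P : 'M[PC]_(m, n)) : dist2 d P P = 0.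
Proof.
by rewrite /dist2 big1 // => k _; rewrite big1 // => i _; rewrite big1 // => j _; rewrite subrr normr0 expr0n.
Qed.

Lemma subset_closure m n d (S : 'M[PC]_(m, n) -> Prop) P :
  (mxsize P <= d.+1)%N -> S P -> closure_d d S P.
Proof.
move=> hP sP; split=> // eps eps0; exists P; split=> //.
by rewrite dist2xx mulr_gt0.
Qed.

Lemma closure_mono m n d (S1 S2 : 'M[PC]_(m, n) -> Prop) :
  psubset S1 S2 -> psubset (closure_d d S1) (closure_d d S2).
Proof.
by move=> h P [hP hS]; split=> // eps /hS [Q [/h]]; exists Q.
Qed.

(** The numbers [delta / k.+1%:R] with [k <= size bad] are distinct and outnumber the excluded
    ones. *)
Lemma small_avoid (bad : seq C) (delta : C) : 0 < delta ->
  exists t : C, [/\ 0 < t, t <= delta & t \notin bad].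
Proof.
move=> d0; pose s := [seq delta / k.+1%:R | k <- iota 0 (size bad).+1].
have us : uniq s.
  rewrite map_inj_uniq ?iota_uniq // => i j /(mulfI (lt0r_neq0 d0)) /invr_inj /eqP.
  by rewrite eqr_nat => /eqP [].
have : ~~ all (mem bad) s.
  apply/negP => /allP h; have := uniq_leq_size us h.
  by rewrite size_map size_iota ltnn.
case/allPn => t /mapP [k _ ->] hk; exists (delta / k.+1%:R); split=> //.
  by rewrite divr_gt0 // ltr0n.
by rewrite ler_pdivrMr ?ltr0n // ler_peMr ?ler1n // ltW.
Qed.

(** Degree two in [t] is what arises when both factors of a product move along lines with the same
    parameter. *)
Lemma closure_curve m n d (S : 'M[PC]_(m, n) -> Prop) (P Q1 Q2 : 'M[PC]_(m, n)) (bad : seq C) :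
  (mxsize P <= d.+1)%N ->
  (forall t, t \notin bad -> S (P + t%:P *: Q1 + (t ^+ 2)%:P *: Q2) /\
     (mxsize (P + t%:P *: Q1 + (t ^+ 2)%:P *: Q2)%R <= d.+1)%N) ->
  closure_d d S P.
Proof.
move=> hP hS; split=> // eps eps0.
pose M : C := \sum_(k < d.+1) \sum_i \sum_j (`|(Q1 i j)`_k| + `|(Q2 i j)`_k|) ^+ 2.
have M0 : 0 <= M.
  by do 3![apply: sumr_ge0 => ? _]; rewrite exprn_ge0 // addr_ge0.
have M1 : 0 < M + 1 by rewrite ltr_wpDl.
have e1 : 0 < 1 + eps by rewrite ltr_pwDl // ltW.
(* Chosen so that [t <= delta] gives both [t <= 1], needed to bound the quadratic term by the linear
   one, and [t * (M + 1) < eps]. *)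
pose delta := eps / ((M + 1) * (1 + eps)).
have d0 : 0 < delta by rewrite divr_gt0 // mulr_gt0.
have [t [t0 td tb]] := small_avoid bad d0.
have [sT bT] := hS t tb; exists (P + t%:P *: Q1 + (t ^+ 2)%:P *: Q2); split=> //.
have tM : t * (M + 1) < eps.
  apply: (@le_lt_trans _ _ (delta * (M + 1))); first by rewrite ler_wpM2r // ltW.
  have -> : delta * (M + 1) = eps / (1 + eps).
    by rewrite /delta; field; rewrite !lt0r_neq0.
  rewrite ltr_pdivrMr // mulrDr mulr1 ltrDl mulr_gt0 //.
have t1 : t <= 1.
  apply: (le_trans td); rewrite /delta ler_pdivrMr ?mulr_gt0 // mul1r.
  rewrite mulrDr mulr1 mulrDl mul1r; apply: (@le_trans _ _ (M * eps + eps)).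
    by rewrite lerDr mulr_ge0 // ltW.
  by rewrite lerDr ltW.
apply: (@le_lt_trans _ _ (t ^+ 2 * M)).
  rewrite /dist2 /M mulr_sumr; apply: ler_sum => k _.
  rewrite mulr_sumr; apply: ler_sum => i _; rewrite mulr_sumr; apply: ler_sum => j _.
  rewrite !mxE !mul_polyC !coefD !coefZ.
  have -> : (P i j)`_k - ((P i j)`_k + t * (Q1 i j)`_k + t ^+ 2 * (Q2 i j)`_k) =
    - (t * ((Q1 i j)`_k + t * (Q2 i j)`_k)) by ring.
  rewrite normrN normrM exprMn (ger0_norm (ltW t0)) ler_pM2l ?exprn_gt0 //.
  rewrite ler_sqr ?nnegrE ?addr_ge0 ?normr_ge0 //.
  apply: (le_trans (ler_normD _ _)); rewrite lerD2l normrM (ger0_norm (ltW t0)).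
  by rewrite ler_piMl.
apply: (@le_lt_trans _ _ ((t * (M + 1)) ^+ 2)).
  rewrite exprMn ler_pM2l ?exprn_gt0 //.
  apply: (@le_trans _ _ (M + 1)); first by rewrite lerDl.
  by rewrite expr2 ler_peMr ?(ltW M1) // lerDr.
by rewrite -expr2 ltr_sqr ?nnegrE ?(ltW eps0) // ltW // mulr_gt0.
Qed.

End Closure.

(** * Balancing degrees, density of MH_a, and the theorem *)

Section Density.
Set Implicit Arguments. Unset Strict Implicit. Unset Printing Implicit Defensive.
Import Order.TTheory GRing.Theory Num.Theory.
Local Open Scope ring_scope.
Variable R : realType.
Local Notation C := R[i].
Local Notation PC := {poly C}.

(** Bounds replace exact degrees, so a degree may drop when a unit is moved; C_a is the case [degRB]
    ([Cset_Gset]). *)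
Definition Gset m n r d (e : 'I_r -> nat) (P : 'M[PC]_(m, n)) :=
  exists (L : 'M[PC]_(m, r)) (B : 'M[PC]_(r, n)),
    [/\ P = L *m B, rowbd e B & rowbd (fun i => d - e i)%N L^T].

Lemma Gset_size m n r d (e : 'I_r -> nat) (P : 'M[PC]_(m, n)) :
  (forall i, (e i <= d)%N) -> Gset d e P -> (mxsize P <= d.+1)%N.
Proof. by move=> he [L [B [-> hB hL]]]; apply: mxsize_mul he hL hB. Qed.

Lemma size_sub_top (p : PC) N : (size p <= N.+1)%N ->
  (size (p - p`_N *: 'X^N)%R <= N)%N.
Proof.
move=> h; apply: size_top_coef0; last by rewrite coefB coefZ coefXn eqxx mulr1 subrr.
apply: (leq_trans (size_polyD _ _)); rewrite geq_max h size_polyN.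
by apply: leq_trans (size_scale_leq _ _) _; rewrite size_polyXn.
Qed.

Lemma size_leD (p q : PC) N : (size p <= N)%N -> (size q <= N)%N ->
  (size (p + q)%R <= N)%N.
Proof. by move=> hp hq; apply: (leq_trans (size_polyD _ _)); rewrite geq_max hp hq. Qed.

Lemma size_leC (c : C) (p : PC) N : (size p <= N)%N -> (size (c%:P * p)%R <= N)%N.
Proof. by move=> hp; rewrite mul_polyC; apply: leq_trans (size_scale_leq _ _) hp. Qed.

Lemma size_leX k (p : PC) M N : (size p <= M)%N -> (k + M <= N)%N ->
  (size ('X^k * p)%R <= N)%N.
Proof.
move=> hp hN; apply: (leq_trans (size_polyMleq _ _)); rewrite size_polyXn addSn /=.
by apply: leq_trans hN; rewrite leq_add2l.
Qed.

Definition move_one r (i j : 'I_r) (e : 'I_r -> nat) k :=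
  if k == i then (e i).-1 else if k == j then (e j).+1 else e k.

(* A degree unit moves from row i to row j in the limit eps -> 0 of the rank-two
   update below; the terms of order 1/eps cancel in the product. *)
Lemma Gset_move_one m n r d (e : 'I_r -> nat) i j (P : 'M[PC]_(m, n)) :
  (forall k, (e k <= d)%N) -> (e j < e i)%N -> Gset d e P ->
  closure_d d (Gset d (move_one i j e)) P.
Proof.
move=> he ji GP; have sP := Gset_size he GP; case: GP => L [B [eP hB hL]].
have hL' u k : (size (L u k) <= (d - e k).+1)%N by have := hL k u; rewrite mxE.
have nij : j != i by apply: contraTneq ji => ->; rewrite ltnn.
(* The largest shift for which ['X^kap] times row [j] of [B] stays below degree [e i] and ['X^kap]
   times column [i] of [L] stays below degree [d - e j]. *)
pose kap := (e i - e j).-1.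
pose b u := (L u j)`_(d - e j); pose q u := L u j - b u *: 'X^(d - e j).
pose c v := (B i v)`_(e i); pose rho v := B i v - c v *: 'X^(e i).
have hid := he i; have hjd : (e j < d)%N by apply: leq_trans ji hid.
have srho v : (size (rho v) <= e i)%N by apply: size_sub_top.
have sq u : (size (q u) <= d - e j)%N by apply: size_sub_top.
pose Q : 'M[PC]_(m, n) := \matrix_(u, v)
  ('X^((d - e i).+1) * ((b u)%:P * rho v) - 'X^((e j).+1) * ((c v)%:P * q u)).
apply: (closure_curve (Q1 := Q) (Q2 := 0) (bad := [:: 0]) sP) => t; rewrite inE => t0.
set P' := P + _ + _.
have he' k : (move_one i j e k <= d)%N.
  by rewrite /move_one; case: eqP => _; [lia | case: eqP => _ //].
suff GP' : Gset d (move_one i j e) P' by split=> //; apply: Gset_size GP'.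
(* The top term [c v] of row [i] is restored by the product of [- 'X^kap * L u i] with the new top
   term of row [j]; the top term [b u] of column [j] is restored symmetrically through column
   [i]. *)
pose L' : 'M[PC]_(m, r) := \matrix_(u, k)
  if k == i then L u i + t%:P * ('X^((d - e i).+1) * (b u)%:P)
  else if k == j then t%:P * q u - 'X^kap * L u i else L u k.
pose B' : 'M[PC]_(r, n) := \matrix_(k, v)
  if k == i then rho v + t^-1%:P * ('X^kap * B j v)
  else if k == j then t^-1%:P * B j v - 'X^((e j).+1) * (c v)%:P else B k v.
have sC (x : C) : (size x%:P <= 1)%N by rewrite size_polyC leq_b1.
exists L', B'; split.
- apply/matrixP => u v; rewrite /P' eP !mxE (bigD1 i) //= (bigD1 j) //=.
  rewrite [in RHS](bigD1 i) //= [X in _ = _ + X](bigD1 j) //=.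
  rewrite [in RHS](eq_bigr (fun k => L u k * B k v)) => [|k /andP [ki kj]]; last first.
    by rewrite !mxE (negbTE ki) (negbTE kj).
  rewrite !mxE eqxx (negbTE nij) eqxx /= mulr0 addr0.
  have eB : B i v = rho v + (c v)%:P * ('X^kap * 'X^((e j).+1)).
    rewrite /rho -exprD; have -> : (kap + (e j).+1 = e i)%N by rewrite /kap; lia.
    by rewrite mul_polyC subrK.
  have eL : L u j = q u + (b u)%:P * ('X^((d - e i).+1) * 'X^kap).
    rewrite /q -exprD; have -> : ((d - e i).+1 + kap = d - e j)%N by rewrite /kap; lia.
    by rewrite mul_polyC subrK.
  have tt : t%:P * t^-1%:P = 1 :> PC by rewrite -polyCM divff.
  rewrite eB eL; set S := \sum_(k < r | _) _.
  (* [ring] treats [t] and its inverse as independent, so the relation between them is split off as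
     a vanishing last summand. *)
  rewrite [RHS](_ : _ = (L u i * (rho v + (c v)%:P * ('X^kap * 'X^((e j).+1))) +
     ((q u + (b u)%:P * ('X^((d - e i).+1) * 'X^kap)) * B j v + S) +
     t%:P * ('X^((d - e i).+1) * ((b u)%:P * rho v) - 'X^((e j).+1) * ((c v)%:P * q u))) +
     (t%:P * t^-1%:P - 1) * ('X^((d - e i).+1) * (b u)%:P * 'X^kap * B j v + q u * B j v)); last by ring.
  by rewrite tt subrr mul0r addr0.
- move=> k v; rewrite mxE /move_one; case: (eqVneq k i) => [_|ki].
    rewrite prednK; last by apply: leq_ltn_trans ji.
    apply: size_leD => //; apply/size_leC/(size_leX (hB j v)); rewrite /kap; lia.
  case: (eqVneq k j) => [_|kj]; last exact: hB.
  apply: size_leD; first by apply: size_leC; apply: leq_trans (hB j v) _; lia.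
  by rewrite size_polyN; apply: (size_leX (sC _)); lia.
move=> k u; rewrite !mxE /move_one; case: (eqVneq k i) => [_|ki].
  apply: size_leD; first by apply: leq_trans (hL' u i) _; lia.
  by apply/size_leC/(size_leX (sC _)); lia.
case: (eqVneq k j) => [_|kj]; last exact: hL'.
apply: size_leD; first by apply: size_leC; apply: leq_trans (sq u) _; lia.
by rewrite size_polyN; apply: (size_leX (hL' u i)); rewrite /kap; lia.
Qed.

Lemma sum_split2 r (i j : 'I_r) (g : 'I_r -> nat) : j != i ->
  (\sum_k g k = g i + (g j + \sum_(k < r | (k != i) && (k != j)) g k))%N.
Proof. by move=> ji; rewrite (bigD1 i) //= (bigD1 j). Qed.

(** Induction on the total excess of [e] over [f]: equal sums provide a row [i] above its target and
    a row [j] below, and [e j < f j <= (f i).+1 <= e i] allows a unit to move. *)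
Lemma Gset_balance m n r d (f : 'I_r -> nat) : (forall i, (f i <= d)%N) ->
  (forall i j, (f i <= (f j).+1)%N) ->
  forall (e : 'I_r -> nat) (P : 'M[PC]_(m, n)), (forall k, (e k <= d)%N) ->
  (\sum_i e i = \sum_i f i)%N -> Gset d e P -> closure_d d (Gset d f) P.
Proof.
move=> hf hff e; have [N] := ubnP (\sum_i (e i - f i))%N.
elim: N e => // N IH e hN P he es GP.
have [h|] := boolP [forall i, (e i <= f i)%N].
  have ef : e = f.
    apply: funext => i; apply/eqP; rewrite eqn_leq (forallP h) /= leqNgt; apply/negP => lt.
    have : (\sum_k e k < \sum_k f k)%N.
      rewrite (bigD1 i) //= [X in (_ < X)%N](bigD1 i) //= -addSn; apply: leq_add => //.
      by apply: leq_sum => k _; apply: (forallP h).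
    by rewrite es ltnn.
  by rewrite -ef; apply: subset_closure (Gset_size he GP) GP.
rewrite negb_forall; case/existsP => i; rewrite -ltnNge => hi.
have [j hj] : exists j, (e j < f j)%N.
  apply: contrapT => hN'; have hge k : (f k <= e k)%N.
    by rewrite leqNgt; apply/negP => lt; apply: hN'; exists k.
  have : (\sum_k f k < \sum_k e k)%N.
    rewrite (bigD1 i) //= [X in (_ < X)%N](bigD1 i) //= -addSn; apply: leq_add => //.
    by apply: leq_sum.
  by rewrite es ltnn.
have nij : j != i by apply: contraTneq hi => <-; rewrite -leqNgt ltnW.
have ji : (e j < e i)%N by have := hff j i; lia.
have he' k : (move_one i j e k <= d)%N.
  by rewrite /move_one; have := he i; have := hf j; case: eqP => _; [lia | case: eqP => _; [lia | by []]].
have oth (g : nat -> 'I_r -> nat) : (\sum_(k < r | (k != i) && (k != j)) g (move_one i j e k) k =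
    \sum_(k < r | (k != i) && (k != j)) g (e k) k)%N.
  by apply: eq_bigr => k /andP [ki kj]; rewrite /move_one (negbTE ki) (negbTE kj).
have mi : move_one i j e i = (e i).-1 by rewrite /move_one eqxx.
have mj : move_one i j e j = (e j).+1 by rewrite /move_one (negbTE nij) eqxx.
have := Gset_move_one he ji GP; apply: closure_trans => Q GQ.
apply: IH he' _ GQ.
  rewrite ltnS in hN; apply: leq_trans hN.
  have := sum_split2 (fun k => move_one i j e k - f k)%N nij.
  have := sum_split2 (fun k => e k - f k)%N nij.
  by rewrite /= mi mj (oth (fun x k => x - f k)%N) /= => -> ->; lia.
rewrite -es; have := sum_split2 (move_one i j e) nij; have := sum_split2 e nij.
by rewrite mi mj (oth (fun x _ => x)) /= => -> ->; lia.
Qed.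

Lemma generic_line n r a (e : 'I_r -> nat) (A : 'M[PC]_(r, n)) :
  (0 < r)%N -> (r < n)%N -> (\sum_i e i = a)%N -> rowbd e A ->
  exists (A0 : 'M[PC]_(r, n)) (bad : seq C), forall t, t \notin bad ->
    [/\ rowbd e (A + t%:P *: A0), pw_free (A + t%:P *: A0),
        row_free (leadmx e (A + t%:P *: A0))
      & minimal_indices (rnull (A + t%:P *: A0)) (right_indices n r a)].
Proof.
move=> r0 rn ea hA; have [A0 hA0 inj] := sysmx_witness R r0 rn ea.
have nuN (k : 'I_n) : (nu_ n r a k <= (a %/ (n - r)).+1)%N by apply: nu_le.
have [bad hbad] := row_free_generic
  (sysmx (fun k : 'I_n => nu_ n r a k) (fun i => e i + (a %/ (n - r)).+1)%N A)
  (sysmx_free nuN hA0 inj).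
exists A0, bad => t /hbad; rewrite -sysmx_line => ft.
have ht : rowbd e (A + t%:P *: A0).
  by move=> i k; rewrite !mxE; apply: size_leD => //; apply: size_leC.
by have [] := sysmx_right_indices rn ea ht ft.
Qed.

Lemma sum_degRB r a : (0 < r)%N -> (\sum_(i < r) degRB a i = a)%N.
Proof.
move=> r0; have h k : (\sum_(0 <= i < k) (i < a %% r) = minn k (a %% r))%N.
  elim: k => [|k IH]; first by rewrite big_nil min0n.
  by rewrite big_nat_recr //= IH; case: (ltnP k (a %% r)) => hk /=; rewrite /minn; case: ltnP; lia.
rewrite (eq_bigr (fun i : 'I_r => (a %/ r + (i < a %% r))%N)) => [|i _].
  rewrite big_split /= sum_nat_const card_ord -(big_mkord xpredT (fun i => nat_of_bool (i < a %% r)%N)) h.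
  by rewrite (minn_idPr _) ?(ltnW (ltn_pmod _ _)) // mulnC -divn_eq.
by rewrite /degRB /tR /dR; case: ifP; rewrite ?addn1 ?addn0.
Qed.

Lemma Cset_Gset m n r d a (P : 'M[PC]_(m, n)) :
  Cset R m n r d a P <-> Gset d (@degRB r a) P.
Proof.
split=> [[L [B [-> h]]]|[L [B [-> hB hL]]]].
  exists L, B; split=> // i j; have := h i; rewrite /degRB; case: ifP => _ [/mxsize_rowP h1];
    rewrite mxsize_col => /mxsize_rowP h2; [exact: h1 | exact: h1 | | exact: h2].
  by apply: leq_trans (h2 j) _; rewrite subn1 subnS.
exists L, B; split=> // i; have hBi := hB i; have hLi := hL i.
move: hBi hLi; rewrite /degRB; case: ifP => _ hBi hLi; rewrite mxsize_col; split; apply/mxsize_rowP => //.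
by move=> j; rewrite subn1 -subnS.
Qed.

(** The left nullspace of [L] is the right nullspace of [L^T], whose row degrees add up to
    [r * d - a]; one analysis thus serves both factors. *)
Lemma right_left_indices m r d a : right_indices m r (r * d - a) = left_indices m r d a.
Proof. by []. Qed.

Lemma Cset_sub_closure_MHset m n r d a : (0 < r)%N -> (r < m)%N -> (r < n)%N ->
  (a <= r * d)%N -> forall P, Cset R m n r d a P -> closure_d d (MHset R m n r d a) P.
Proof.
move=> r0 rm rn ad P /Cset_Gset GP.
have hd (i : 'I_r) : (degRB a i <= d)%N := degRB_le i ad.
have sP := Gset_size hd GP; case: GP => L [B [eP hB hL]].
have sR := sum_degRB a r0.
have sL : (\sum_(i < r) (d - degRB a i) = r * d - a)%N.
  have : (\sum_(i < r) (d - degRB a i) + \sum_(i < r) degRB a i = r * d)%N.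
    rewrite -big_split /= -[in RHS](card_ord r) -sum_nat_const.
    by apply: eq_bigr => i _; rewrite subnK.
  by rewrite sR => <-; rewrite addnK.
have [B0 [bad1 h1]] := generic_line r0 rn sR hB.
have [L0 [bad2 h2]] := generic_line r0 rm sL hL.
pose Q1 := L *m B0 + L0^T *m B; pose Q2 := L0^T *m B0.
apply: (closure_curve (Q1 := Q1) (Q2 := Q2) (bad := bad1 ++ bad2) sP) => t.
rewrite mem_cat negb_or => /andP [/h1 [bB pB lB iB] /h2 [bL pL lL iL]].
set Bt := B + _ in bB pB lB iB; set Lt := L^T + _ in bL pL lL iL.
have -> : P + t%:P *: Q1 + (t ^+ 2)%:P *: Q2 = Lt^T *m Bt.
  have -> : Lt^T = L + t%:P *: L0^T by apply/matrixP => u k; rewrite !mxE.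
  rewrite /Bt /Q1 /Q2 eP mulmxDl !mulmxDr.
  rewrite -!scalemxAl -!scalemxAr scalerA -polyCM -expr2 scalerDr !addrA.
  congr (_ + _); by rewrite -!addrA; congr (_ + _); rewrite addrC.
clearbody Bt Lt; split; last by apply: (mxsize_mul hd); rewrite ?trmxK.
exists Lt^T, Bt; split; first by [].
split.
- split.
  + by move=> i; rewrite mxsize_col trmxK !(rowdeg_reduced bB lB, rowdeg_reduced bL lL).
  + by rewrite trmxK; apply: reduced_minimal bL lL pL.
  + exact: reduced_minimal bB lB pB.
- by rewrite -right_left_indices; move: iL; rewrite /rnull /lnull fracmx_tr.
exact: iB.
Qed.

Lemma Aset_sub_closure_Cset m n r d a : (0 < r)%N -> (a <= r * d)%N ->
  forall P, Aset R m n r d a P -> closure_d d (Cset R m n r d a) P.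
Proof.
move=> r0 ad P [L [B [eP [e [he se]]]]].
have cl : closure_d d (Gset d (@degRB r a)) P.
  have hd (i : 'I_r) : (degRB a i <= d)%N := degRB_le i ad.
  have hb (i j : 'I_r) : (degRB a i <= (degRB a j).+1)%N.
    by rewrite /degRB; case: ifP => _; case: ifP => _; lia.
  apply: (@Gset_balance m n r d _ hd hb e P) => [k||]; first by case: (he k).
    by rewrite se sum_degRB.
  exists L, B; split=> // i j; have [_ h1 h2] := he i.
    by move: j; apply/mxsize_rowP; rewrite h1.
  by move: j; apply/mxsize_rowP; rewrite -mxsize_col h2.
by apply: closure_mono cl => Q /Cset_Gset.
Qed.

Lemma Bset_sub_Aset m n r d a : (0 < r)%N -> (a <= r * d)%N ->
  psubset (Bset R m n r d a) (Aset R m n r d a).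
Proof.
move=> r0 ad P [L [B [-> h]]]; exists L, B; split=> //; exists (@degRB r a).
by split=> [i|]; [have [h1 h2] := h i; split=> //; apply: degRB_le | apply: sum_degRB].
Qed.

Lemma Bset_sub_Cset m n r d a : psubset (Bset R m n r d a) (Cset R m n r d a).
Proof.
move=> P [L [B [-> h]]]; apply/Cset_Gset; exists L, B; split=> // i.
  by apply/mxsize_rowP; rewrite (proj1 (h i)).
by apply/mxsize_rowP; rewrite -mxsize_col (proj2 (h i)).
Qed.

(** Meant for [S] equal to MH_a, which is contained in each of the other sets and dense in it. *)
Lemma pset_eq_closure m n d (X Y S : 'M[PC]_(m, n) -> Prop) :
  psubset S X -> psubset S Y -> (forall P, X P -> closure_d d S P) ->
  (forall P, Y P -> closure_d d S P) -> pset_eq (closure_d d X) (closure_d d Y).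
Proof.
move=> SX SY Xc Yc P; split.
  by move=> /(closure_trans Xc) /(closure_mono SY).
by move=> /(closure_trans Yc) /(closure_mono SX).
Qed.

End Density.

Theorem theorem4p17 (R : realType) (m n r d : nat) :
  (2 <= m)%N -> (2 <= n)%N -> (1 <= d)%N -> (0 < r)%N -> (r < minn m n)%N ->
  forall a : nat, (a <= r * d)%N ->
    [/\ psubset (Oset R m n r d a) (Aset R m n r d a),
        psubset (MHset R m n r d a) (Oset R m n r d a)
      & let cl := closure_d d in
        [/\ pset_eq (cl (Oset R m n r d a)) (cl (MHset R m n r d a)),
            pset_eq (cl (MHset R m n r d a)) (cl (Mset R m n r d a)),
            pset_eq (cl (Mset R m n r d a)) (cl (Bset R m n r d a)),
            pset_eq (cl (Bset R m n r d a)) (cl (Cset R m n r d a))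
          & pset_eq (cl (Cset R m n r d a)) (cl (Aset R m n r d a))]].
Proof.
move=> _ _ _ r0 rmn a ad.
have /andP [rm rn] : (r < m)%N && (r < n)%N by rewrite -leq_min.
have OA := Oset_sub_Aset (R := R) r0 rmn ad.
have MHO := MHset_sub_Oset (R := R) (m := m) (n := n) ad.
have MHM : psubset (MHset R m n r d a) (Mset R m n r d a).
  by move=> P [L [B [-> []]]]; exists L, B.
have MB : psubset (Mset R m n r d a) (Bset R m n r d a).
  by move=> P [L [B [-> []]]]; exists L, B.
have BA := Bset_sub_Aset (R := R) (m := m) (n := n) r0 ad.
have BC := @Bset_sub_Cset R m n r d a.
have Ccl := @Cset_sub_closure_MHset R m n r d a r0 rm rn ad.
have Acl P : Aset R m n r d a P -> closure_d d (MHset R m n r d a) P.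
  by move=> /(Aset_sub_closure_Cset r0 ad) /(closure_trans Ccl).
have MHcl P : MHset R m n r d a P -> closure_d d (MHset R m n r d a) P.
  by move=> /MHO /OA /Acl.
split=> //; split; apply: (pset_eq_closure (S := MHset R m n r d a));
  by [| move=> P; auto].
Qed.
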